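(* Let $E$ be the elliptic curve $y^2=x^3-x+1$ over an algebraically closed field of characteristic $0$. Then $\lambda_0(3,E)=6$. In particular, $\lambda_0^{\mathrm{gen}}(3)=6$.
   Context: Let $\mathbb{K}$ be an algebraically closed field of characteristic $0$. On a smooth genus one curve $E$ over $\mathbb{K}$, all nonsplit extensions $0\to\mathcal{O}_E\to\mathcal{V}\to\mathcal{O}_E\to 0$ give the same rank $2$ bundle $\mathcal{V}$. The Atiyah ruled surface is $S=\underline{\mathrm{Proj}}_E\,\mathrm{Sym}(\mathcal{V}^\vee)$ (parametrizing lines in the fibers of $\mathcal{V}$), with projection $\rho:S\to E$; $E_\infty\subset S$ is the section induced by $\mathcal{O}_E\subset\mathcal{V}$. Fix $q\in E(\mathbb{K})$ and let $F_q=\rho^{-1}(q)$. For $m\ge 1$ and $\mathcal{D}\in\mathrm{Pic}^0(E)$, choose a closed point $x\in S\setminus E_\infty$ with $\mathcal{O}_E(\rho(x)-q)\cong\mathcal{D}$ and let $\lambda_0(m,E,\mathcal{D})$ be the minimal $\ell\ge 0$ for which there exists a curve $C\in|F_q+\ell E_\infty|$ of multiplicity at least $m$ at $x$ (this depends only on $m,E,\mathcal{D}$). Put $\lambda_0(m,E)=\max_{\mathcal{D}\in\mathrm{Pic}^0(E)}\lambda_0(m,E,\mathcal{D})$ and $\lambda_0^{\mathrm{gen}}(m)=\max_E\lambda_0(m,E)$, the maximum over all smooth genus one curves $E$ over $\mathbb{K}$. The subscript $0$ indicates $\mathrm{char}(\mathbb{K})=0$. *)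

(* Defs.v *)
From HB Require Import structures.
From mathcomp Require Import all_boot all_order all_algebra.
From mathcomp Require Import boolp.
From mathcomp.multinomials Require Import freeg.

Set Implicit Arguments.
Unset Strict Implicit.
Unset Printing Implicit Defensive.

Import Order.TTheory GRing.Theory Num.Theory.

Local Open Scope ring_scope.

(* A smooth projective curve over the algebraically closed field K is handled
   as the abstract nonsingular curve of its function field F (Hartshorne I.6):
   its closed points are the discrete valuation rings of F over K. *)

(* F is finite over K(x) for some x transcendental over K. *)
Definition is_function_field (K F : fieldType) (iota : {rmorphism K -> F}) : Prop :=
  exists x : F,
    (forall P : {poly K}, P != 0 -> (map_poly iota P).[x] != 0) /\
    (exists (n : nat) (e : 'I_n -> F), forall z : F,
       exists P Q : 'I_n -> {poly K},
         (forall i, Q i != 0) /\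
         z = \sum_(i < n) (map_poly iota (P i)).[x] / (map_poly iota (Q i)).[x] * e i).

Record curve (K : closedFieldType) := Curve {
  funfield :> fieldType;
  const : {rmorphism K -> funfield};
  curveP : is_function_field const }.

(* A normalized discrete valuation of the function field, trivial on K.  The
   value at 0 (mathematically +oo) is fixed to be 0, so that a place is
   determined by its valuation ring. *)
Record place (K : closedFieldType) (C : curve K) := Place {
  val :> C -> int;
  val0 : val 0 = 0;
  valM : forall f g : C, f != 0 -> g != 0 -> val (f * g) = val f + val g;
  valD : forall f g : C, f != 0 -> g != 0 -> f + g != 0 ->
    Num.min (val f) (val g) <= val (f + g);
  valK : forall c : K, c != 0 -> val (const C c) = 0;
  val_uniformizer : exists2 f : C, f != 0 & val f = 1 }.

HB.instance Definition _ (K : closedFieldType) (C : curve K) :=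
  gen_eqMixin (place C).
HB.instance Definition _ (K : closedFieldType) (C : curve K) :=
  gen_choiceMixin (place C).

(* v_p(f) >= n, with v_p(0) = +oo. *)
Definition vge (K : closedFieldType) (C : curve K) (p : place C) (n : int) (f : C) : bool :=
  (f == 0) || (n <= p f).

Definition divisor (K : closedFieldType) (C : curve K) := {freeg (place C) / int}.

(* D - D' is principal, i.e. O(D) and O(D') are isomorphic. *)
Definition lin_equiv (K : closedFieldType) (C : curve K) (D D' : divisor C) : Prop :=
  exists2 f : C, f != 0 & forall p : place C, p f = coeff p D - coeff p D'.

(* H^0(C, O(A)). *)
Definition riemann_space (K : closedFieldType) (C : curve K) (A : divisor C) (f : C) : Prop :=
  forall p : place C, vge p (- coeff p A) f.

Definition riemann_dim_ge (K : closedFieldType) (C : curve K) (A : divisor C) (n : nat) : Prop :=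
  exists e : 'I_n -> C,
    (forall i, riemann_space A (e i)) /\
    (forall c : 'I_n -> K, \sum_(i < n) const C (c i) * e i = 0 -> forall i, c i = 0).

Definition riemann_dim (K : closedFieldType) (C : curve K) (A : divisor C) (n : nat) : Prop :=
  riemann_dim_ge A n /\ ~ riemann_dim_ge A n.+1.

(* g = max_A (deg A - dim H^0(C, O(A)) + 1), Riemann's definition of the genus. *)
Definition has_genus (K : closedFieldType) (C : curve K) (g : nat) : Prop :=
  (forall (A : divisor C) (n : nat), riemann_dim A n -> deg A - n%:Z + 1 <= g%:Z) /\
  (exists (A : divisor C) (n : nat), riemann_dim A n /\ deg A - n%:Z + 1 = g%:Z).

(* Extensions 0 -> O -> V -> O -> 0.  The generic fibre of V is F^2, where O is
   embedded in the first coordinate and the quotient is the second coordinate.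
   The stalk of V at p is an O_p-lattice which meets the first coordinate axis
   in O_p and projects onto O_p, so it has a basis (1, 0), (r_p, 1), where
   r_p is in F, and in O_p for almost all p. *)
Record extension (K : closedFieldType) (C : curve K) := Extension {
  ext :> place C -> C;
  ext_finite : exists s : seq (place C), forall p : place C, p \notin s -> vge p 0 (ext p) }.

Definition stalk (K : closedFieldType) (C : curve K) (r : extension C) (p : place C)
    (v : C * C) : Prop :=
  exists a b : C, [/\ vge p 0 a, vge p 0 b & v = (a + b * r p, b)].

(* A splitting maps the global section 1 of the quotient to a global section
   of V whose second coordinate is 1. *)
Definition split_extension (K : closedFieldType) (C : curve K) (r : extension C) : Prop :=
  exists g : C, forall p : place C, stalk r p (g, 1).

(* The surface S = Proj Sym (V^\vee) of lines in the fibres of V, for a nonsplit V,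
   with the base point q.  The line spanned by (a, b) has the affine coordinate
   t = a / b, and E_oo is t = oo.  In the basis of the stalk of V at p given
   above, the fibre coordinate is s = t - r_p, so that over Spec O_p the open
   set S \ E_oo is Spec O_p[s]. *)
Record atiyah_surface (K : closedFieldType) := AtiyahSurface {
  base : curve K;
  basept : place base;
  bundle : extension base;
  nonsplit : ~ split_extension bundle }.

(* g(t) rewritten in terms of s = t - r_p. *)
Definition local_form (K : closedFieldType) (S : atiyah_surface K) (p : place (base S))
    (g : {poly base S}) : {poly base S} :=
  g \Po ('X + (bundle S p)%:P).

(* H^0(S, O(F_q + l E_oo)): the rational functions on S with at most a simple
   pole along F_q, at most a pole of order l along E_oo, and no other pole.
   On the generic fibre of S these are the polynomials in t of degree <= l; as
   u = 1 / s is a local equation of E_oo, regularity of u^l g along E_oo is the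
   same condition on the coefficients in s as regularity off E_oo. *)
Definition section (K : closedFieldType) (S : atiyah_surface K) (l : nat)
    (g : {poly base S}) : Prop :=
  (size g <= l.+1)%N /\
  (forall (p : place (base S)) (i : nat),
     vge p (- coeff p << basept S >>) (local_form p g)`_i).

(* A closed point of S \ E_oo: its image in the base curve and the value of the
   fibre coordinate s there. *)
Definition affine_point (K : closedFieldType) (S : atiyah_surface K) : Type :=
  (place (base S) * K)%type.

(* O_p[s] *)
Definition chart_ring (K : closedFieldType) (C : curve K) (p : place C)
    (h : {poly C}) : Prop :=
  forall i : nat, vge p 0 h`_i.

(* The maximal ideal of O_p[s] at the point s = c of the fibre over p. *)
Definition max_ideal (K : closedFieldType) (C : curve K) (p : place C) (c : K)
    (h : {poly C}) : Prop :=
  chart_ring p h /\ vge p 1 h.[const C c].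

(* The powers of an ideal M of a subring A of R. *)
Inductive ideal_pow (R : comNzRingType) (A M : R -> Prop) : nat -> R -> Prop :=
| ideal_pow0 a : A a -> ideal_pow A M 0 a
| ideal_powM n a b : M a -> ideal_pow A M n b -> ideal_pow A M n.+1 (a * b)
| ideal_powD n a b :
    ideal_pow A M n a -> ideal_pow A M n b -> ideal_pow A M n (a + b).

(* The curve C in |F_q + l E_oo| defined by the section g has multiplicity at
   least m at x.  The function u is a local equation of F_q near x, so u * g is
   one of C; it has to be in the m-th power of the maximal ideal of the local
   ring of S at x, which is the localization of O_p[s] at max_ideal p c. *)
Definition mult_ge (K : closedFieldType) (S : atiyah_surface K) (x : affine_point S)
    (m : nat) (g : {poly base S}) : Prop :=
  let: (p, c) := x in
  exists u : base S,
    [/\ u != 0, p u = coeff p << basept S >> &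
      exists d : {poly base S},
        [/\ chart_ring p d, ~ max_ideal p c d &
            ideal_pow (chart_ring p) (max_ideal p c) m
              (d * (u%:P * local_form p g))]].

(* Curves in the linear system |F_q + l E_oo| are given by nonzero sections. *)
Definition has_curve (K : closedFieldType) (S : atiyah_surface K) (m : nat)
    (x : affine_point S) (l : nat) : Prop :=
  exists g : {poly base S}, [/\ g != 0, section l g & mult_ge x m g].

(* lambda_0(m, E, D) = l; the class in Pic^0 is represented by a divisor D of
   degree 0.  The value does not depend on the choice of x. *)
Definition lambda0 (K : closedFieldType) (S : atiyah_surface K) (m : nat)
    (D : divisor (base S)) (l : nat) : Prop :=
  exists x : affine_point S,
    [/\ lin_equiv (<< x.1 >> - << basept S >>) D,
        has_curve m x l &
        forall l' : nat, has_curve m x l' -> (l <= l')%N].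

(* For a function on dom given by its graph f: all values are defined, and n is
   the largest one. *)
Definition is_max (I : Type) (dom : I -> Prop) (f : I -> nat -> Prop) (n : nat) : Prop :=
  [/\ forall i, dom i -> exists k, f i k,
      exists i, dom i /\ f i n &
      forall i k, dom i -> f i k -> (k <= n)%N].

(* lambda_0(m, E) = n *)
Definition lambda0_curve (K : closedFieldType) (m : nat) (S : atiyah_surface K)
    (n : nat) : Prop :=
  is_max (fun D : divisor (base S) => deg D = 0) (lambda0 m) n.

(* lambda_0^gen(m) = n; the index S stands for the curve E = base S together
   with the auxiliary choices of q and of a nonsplit extension. *)
Definition lambda0_gen (K : closedFieldType) (m n : nat) : Prop :=
  is_max (fun S : atiyah_surface K => has_genus (base S) 1) (lambda0_curve m) n.

(* P(x, y) for a bivariate polynomial P with coefficients in K. *)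
Definition eval2 (K : closedFieldType) (C : curve K) (P : {poly {poly K}}) (x y : C) : C :=
  (map_poly (map_poly (const C)) P).[x%:P].[y].

(* The function field of C is K(x, y) with y^2 = x^3 - x + 1, i.e. C is the
   smooth projective model of this affine curve. *)
Definition is_curve_y2_x3_x_1 (K : closedFieldType) (C : curve K) : Prop :=
  exists x y : C,
    y ^+ 2 = x ^+ 3 - x + 1 /\
    (forall z : C, exists P Q : {poly {poly K}},
       eval2 Q x y != 0 /\ z = eval2 P x y / eval2 Q x y).

(* Main.v *)
Require Import Defs.
From mathcomp.multinomials Require Import freeg.
From mathcomp Require Import all_boot all_order all_algebra qfpoly generic_quotient.
From mathcomp Require Import boolp.
From mathcomp Require Import ring zify.

Set Implicit Arguments.
Unset Strict Implicit.
Unset Printing Implicit Defensive.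

Import Order.TTheory GRing.Theory Num.Theory.

Local Open Scope ring_scope.

(** Upper bound: on a curve of genus one H^1(E, O(q)) = 0, so
    H^0(S, O(F_q + l E_oo)) has dimension l + 1, and multiplicity 3 at a point is
    6 linear conditions; for l = 6 a nonzero section remains.  Riemann's
    definition of the genus gives all that is needed of the Riemann-Roch theorem
    by comparing dimensions.

    Lower bound: translating the curve, one may take for q the point at infinity
    of y^2 = x^3 - x + 1, and t = y / x + O(1) at q.  The sections for l = 5 are
    then the combinations of 1, t, t^2 - x, t^3 - 3xt + 2y,
    t^4 - 6xt^2 + 8yt - 3x^2 and t^5 - 10xt^3 + 20yt^2 - 15x^2t + 4xy.  At
    (x, y) = (0, 1), t = 0, the determinant of the 6 conditions of multiplicity 3
    is disc (x^3 - x + 1) = - 23 up to sign and a power of 2, hence not 0. *)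

(** * Valuations *)

(** The curve is known only through its function field and a place only through the axioms of a
    valuation, so residues, degrees and the places themselves have to be recovered first. Two facts
    carry the argument. Every residue field is [K], so that a further order of vanishing costs at
    most one dimension. In genus one, L(q) = [K]: this yields the vanishing of H^1(E, O(q)), and on
    the elliptic curve it makes each coefficient of a section a constant up to known terms. Since
    H^1(E, O) is spanned by the class of a simple pole at q, the function [y / x] can stand for
    every nonsplit extension, up to a change of the coordinate t.

    The upper bound holds at each point of every surface over a curve of genus one, which is also
    why all the minima and maxima exist. That it is reached has to be checked for a single class on
    a single curve, but such a surface then has to be constructed. *)

Lemma mulrn_int (k : int) n : k *+ n = k * n%:Z.
Proof. by rewrite pmulrn mulrzz. Qed.

Section Valuation.
Variables (K : closedFieldType) (C : curve K) (p : place C).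
Implicit Types (f g h : C) (n m : int) (c : K).

Lemma val_const c : c != 0 -> p (const C c) = 0.
Proof. exact: Defs.valK. Qed.

Lemma valM f g : f != 0 -> g != 0 -> p (f * g) = p f + p g.
Proof. exact: Defs.valM. Qed.

Lemma val1 : p 1 = 0.
Proof. by rewrite -(rmorph1 (const C)) val_const ?oner_neq0. Qed.

Lemma valV f : p f^-1 = - p f.
Proof.
have [->|f0] := eqVneq f 0; first by rewrite invr0 val0 oppr0.
by apply/eqP; rewrite -addr_eq0 -valM ?invr_eq0 // mulVf // val1.
Qed.

Lemma valX f k : p (f ^+ k) = p f *+ k.
Proof.
have [->|f0] := eqVneq f 0; first by rewrite expr0n; case: k => [|k]; rewrite ?val1 ?val0 ?mul0rn.
by elim: k => [|k IH]; rewrite ?val1 // exprS valM ?expf_neq0 // IH mulrS.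
Qed.

Lemma valN f : p (- f) = p f.
Proof.
have [->|f0] := eqVneq f 0; first by rewrite oppr0.
by rewrite -mulN1r valM ?oppr_eq0 ?oner_neq0 // -(rmorph1 (const C)) -rmorphN val_const ?oppr_eq0 ?oner_neq0 // add0r.
Qed.

Lemma vge0 n : vge p n 0.
Proof. by rewrite /vge eqxx. Qed.

Lemma vgeE n f : f != 0 -> vge p n f = (n <= p f).
Proof. by move=> /negbTE f0; rewrite /vge f0. Qed.

Lemma vgeW n m f : m <= n -> vge p n f -> vge p m f.
Proof. by rewrite /vge => mn /orP[->//|/(le_trans mn) ->]; rewrite orbT. Qed.

Lemma vgeD n f g : vge p n f -> vge p n g -> vge p n (f + g).
Proof.
have [->|f0] := eqVneq f 0; first by rewrite add0r.
have [->|g0] := eqVneq g 0; first by rewrite addr0.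
have [->|fg0] := eqVneq (f + g) 0; first by rewrite vge0.
by rewrite !vgeE // => nf ng; apply: le_trans (Defs.valD p f0 g0 fg0); rewrite le_min nf.
Qed.

Lemma vgeN n f : vge p n (- f) = vge p n f.
Proof. by rewrite /vge oppr_eq0 valN. Qed.

Lemma vgeB n f g : vge p n f -> vge p n g -> vge p n (f - g).
Proof. by move=> nf ng; apply: vgeD => //; rewrite vgeN. Qed.

Lemma vgeM n m f g : vge p n f -> vge p m g -> vge p (n + m) (f * g).
Proof.
have [->|f0] := eqVneq f 0; first by rewrite mul0r => *; apply: vge0.
have [->|g0] := eqVneq g 0; first by rewrite mulr0 => *; apply: vge0.
by rewrite !vgeE ?mulf_neq0 // valM // => *; apply: lerD.
Qed.

Lemma vge_const c : vge p 0 (const C c).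
Proof.
by have [->|c0] := eqVneq c 0; rewrite ?rmorph0 ?vge0 // vgeE ?fmorph_eq0 // val_const.
Qed.

Lemma vge_residue f c : vge p 1 (f - const C c) -> vge p 0 f.
Proof.
by move=> fc; rewrite -[f](subrK (const C c)); apply: vgeD (vge_const c); apply: vgeW fc.
Qed.

Lemma vge1 : vge p 0 1.
Proof. by rewrite vgeE ?oner_neq0 // val1. Qed.

Lemma vgeMl n f g : vge p 0 f -> vge p n g -> vge p n (f * g).
Proof. by move=> ? ?; rewrite -[n]add0r vgeM. Qed.

Lemma vgeZ n c f : vge p n f -> vge p n (const C c * f).
Proof. by apply: vgeMl; apply: vge_const. Qed.

Lemma vge_nat k : vge p 0 (k%:R : C).
Proof. by rewrite -(rmorph_nat (const C)) vge_const. Qed.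

Lemma vgeX n f k : vge p n f -> vge p (n *+ k) (f ^+ k).
Proof.
move=> nf; elim: k => [|k IH]; first by rewrite vge1.
by rewrite exprS mulrS vgeM.
Qed.

Lemma vgeX0 f k : vge p 0 f -> vge p 0 (f ^+ k).
Proof. by move=> /(vgeX k); rewrite mul0rn. Qed.

Lemma vge_sum (I : Type) (r : seq I) (P : pred I) (F : I -> C) n :
  (forall i, P i -> vge p n (F i)) -> vge p n (\sum_(i <- r | P i) F i).
Proof. by move=> h; elim/big_ind: _ => //; [apply: vge0 | apply: vgeD]. Qed.

Lemma vge_divr n m f g : g != 0 -> p g = m -> vge p n (f * g) -> vge p (n - m) f.
Proof.
move=> g0 gm; have [-> _|f0] := eqVneq f 0; first exact: vge0.
by rewrite !vgeE ?mulf_neq0 // valM // gm lerBlDr.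
Qed.

Lemma vge_mull n f g : f != 0 -> p f = 0 -> vge p n (f * g) = vge p n g.
Proof.
move=> f0 pf; rewrite /vge mulf_eq0 (negbTE f0) /=.
by have [//|g0] := eqVneq g 0; rewrite valM // pf add0r.
Qed.

Lemma vgeNE f : ~~ vge p 0 f = (p f < 0).
Proof. by rewrite /vge negb_or -ltNge; have [->|//] := eqVneq f 0; rewrite val0 ltxx. Qed.

Lemma val_gt0 f : 0 < p f -> f != 0.
Proof. by apply: contraTneq => ->; rewrite val0 ltxx. Qed.

Lemma val_lt0 f : p f < 0 -> f != 0.
Proof. by apply: contraTneq => ->; rewrite val0 ltxx. Qed.

Lemma val_addr f g : f != 0 -> vge p (p f + 1) g -> f + g != 0 /\ p (f + g) = p f.
Proof.
move=> f0 vg.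
have n0 : f + g != 0.
  apply: contraTneq vg => /eqP; rewrite addrC addr_eq0 => /eqP ->.
  by rewrite vgeN vgeE //; lia.
split=> //; have [g0|g0] := eqVneq g 0; first by rewrite g0 addr0.
move: vg; rewrite vgeE // => vg.
apply/eqP; rewrite eq_le; apply/andP; split; last first.
  by have := Defs.valD p f0 g0 n0; lia.
rewrite leNgt; apply/negP => lt.
have := @Defs.valD _ _ p (f + g) (- g) n0.
by rewrite addrK oppr_eq0 valN => /(_ g0 f0); lia.
Qed.

Lemma val_unit f c : c != 0 -> vge p 1 (f - const C c) -> f != 0 /\ p f = 0.
Proof.
move=> c0 h; have cc : const C c != 0 by rewrite fmorph_eq0.
have := @val_addr (const C c) (f - const C c) cc.
by rewrite val_const // add0r (addrC (const C c)) subrK => /(_ h).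
Qed.

Lemma const_vge1 c : vge p 1 (const C c) -> c = 0.
Proof.
by have [//|c0] := eqVneq c 0; rewrite vgeE ?fmorph_eq0 // val_const.
Qed.

(** The nonzero term of least valuation would dominate the sum. Linear independence of functions
    with distinct pole orders and the contradictions in [residue] come from this. *)
Lemma sum_distinct_val (I : finType) (F : I -> C) :
  (forall i j, F i != 0 -> F j != 0 -> p (F i) = p (F j) -> i = j) ->
  \sum_i F i = 0 -> forall i, F i = 0.
Proof.
move=> inj s0 i; apply/eqP/negPn/negP => Fi.
case: (@arg_minP _ _ _ i (fun i => F i != 0) (fun i => p (F i)) Fi) => j Fj jmin.
have h : vge p (p (F j) + 1) (\sum_(k | k != j) F k).
  apply: vge_sum => k kj; have [->|Fk] := eqVneq (F k) 0; first exact: vge0.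
  rewrite vgeE // -ltzD1 ltrD2r lt_neqAle jmin // andbT.
  by apply: contra kj => /eqP e; apply/eqP; apply: inj.
by have := (val_addr Fj h).1; rewrite -[X in X != 0](bigD1 j (P := xpredT)) //= s0 eqxx.
Qed.

End Valuation.

#[global] Hint Resolve vge0 vge1 vge_const vge_nat : core.

(** * Residue fields of places *)

Section Residue.
Variables (K : closedFieldType) (C : curve K).

(* F is spanned by n elements over K(x), so the n + 1 first powers of f are the
   rows of a square matrix over K[x], padded with a zero column: its determinant
   vanishes. *)
Lemma algebraic_dependence : exists x : C,
  (forall P : {poly K}, P != 0 -> (map_poly (const C) P).[x] != 0) /\
  forall f : C, exists (n : nat) (u : 'I_n -> {poly K}),
    (exists i, u i != 0) /\ \sum_(j < n) (map_poly (const C) (u j)).[x] * f ^+ j = 0.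
Proof.
have [x [tr [n [e sp]]]] := curveP C; exists x; split => // f.
pose ev P := (map_poly (const C) P).[x].
have evM P Q : ev (P * Q) = ev P * ev Q by rewrite /ev rmorphM hornerM.
have /boolp.choice [PQ hPQ] : forall j : 'I_n.+1, exists PQ : ('I_n -> {poly K}) * ('I_n -> {poly K}),
    (forall i, PQ.2 i != 0) /\ f ^+ j = \sum_(i < n) ev (PQ.1 i) / ev (PQ.2 i) * e i.
  by move=> j; have [P [Q h]] := sp (f ^+ j); exists (P, Q).
pose q := \prod_(j < n.+1) \prod_(i < n) (PQ j).2 i.
have q0 : q != 0.
  by apply/prodf_neq0 => j _; apply/prodf_neq0 => i _; have [] := hPQ j.
have /boolp.choice [R hR] : forall ji : 'I_n.+1 * 'I_n, exists R, q = R * (PQ ji.1).2 ji.2.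
  move=> [j i] /=; rewrite /q (bigD1 j) //= (bigD1 i) //= -mulrA mulrC.
  by eexists.
pose M : 'M[{poly K}]_n.+1 :=
  \matrix_(j, i) if insub (val i) is Some i' then R (j, i') * (PQ j).1 i' else 0.
have M0 : \det M = 0.
  rewrite -det_tr; apply/eqP/det0P; exists (delta_mx 0 ord_max).
    by apply/eqP => /matrixP/(_ 0 ord_max); rewrite !mxE !eqxx => /eqP; rewrite oner_eq0.
  apply/rowP => j; rewrite !mxE big1 // => i _; rewrite !mxE eqxx /=.
  have [->|] := eqVneq i ord_max; last by rewrite mul0r.
  by case: insubP => [u|_]; rewrite ?ltnn ?mulr0.
have /det0P [v v0 vM] : \det M == 0 by rewrite M0.
exists n.+1, (fun j => v 0 j); split.
  by apply/rV0Pn.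
apply: (mulfI (tr _ q0)); rewrite mulr0 mulr_sumr.
have term (j : 'I_n.+1) : ev q * (ev (v 0 j) * f ^+ j) =
    \sum_(i < n) ev (v 0 j * (R (j, i) * (PQ j).1 i)) * e i.
  have [Q0 ->] := hPQ j.
  rewrite !mulr_sumr; apply: eq_bigr => i _.
  have Qi : ev ((PQ j).2 i) != 0 by apply/tr/Q0.
  by rewrite (hR (j, i)) !evM /=; field.
rewrite (eq_bigr _ (fun j _ => term j)).
rewrite exchange_big big1 // => i _; rewrite -mulr_suml /=.
suff -> : \sum_(j < n.+1) ev (v 0 j * (R (j, i) * (PQ j).1 i)) = 0 by rewrite mul0r.
rewrite -(horner_sum _ _) -(rmorph_sum (map_poly (const C))) /=.
have /rowP/(_ (widen_ord (leqnSn n) i)) := vM; rewrite !mxE => h.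
have -> : \sum_(j < n.+1) v 0 j * (R (j, i) * (PQ j).1 i) = 0.
  rewrite -[RHS]h; apply: eq_bigr => j _; rewrite mxE; case: insubP => [i' _ e'|]; last by rewrite /= ltn_ord.
  by have -> : i = i' by apply: val_inj.
by rewrite rmorph0 horner0.
Qed.

(* Otherwise all nonzero polynomials in f would be units of O_p, so a nontrivial
   relation between f and x would have terms of distinct valuations as soon as
   v(x - c) != 0, and p would be trivial on K(x) if v(x - c) = 0 for all c. *)
Lemma residue (p : place C) (f : C) : vge p 0 f -> exists c : K, vge p 1 (f - const C c).
Proof.
move=> f0; apply/not_existsP => nc.
have [x [tr alg]] := algebraic_dependence.
have unit_of (z : C) : (forall c, z - const C c != 0 /\ p (z - const C c) = 0) ->
    forall P : {poly K}, P != 0 ->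
      (map_poly (const C) P).[z] != 0 /\ p (map_poly (const C) P).[z] = 0.
  move=> hz P P0; have [r ->] := closed_field_poly_normal P.
  rewrite -mul_polyC rmorphM /= map_polyC /= hornerM hornerC rmorph_prod horner_prod.
  have l0 : const C (lead_coef P) != 0 by rewrite fmorph_eq0 lead_coef_eq0.
  suff [m0 pm] : \prod_(i <- r) (map_poly (const C) ('X - i%:P)).[z] != 0 /\
     p (\prod_(i <- r) (map_poly (const C) ('X - i%:P)).[z]) = 0.
     by rewrite mulf_neq0 // valM // val_const ?lead_coef_eq0 // pm.
  apply: (big_ind (fun g : C => g != 0 /\ p g = 0)) => [|a b [a0 pa] [b0 pb]|c _].
  - by rewrite oner_neq0 val1.
  - by rewrite mulf_neq0 // valM // pa pb.
  - by rewrite map_polyXsubC hornerXsubC.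
have hf c : f - const C c != 0 /\ p (f - const C c) = 0.
  have /negP := nc c; rewrite /vge negb_or -ltNge => /andP[n0 lt]; split => //.
  have : vge p 0 (f - const C c) by rewrite vgeB.
  by rewrite vgeE //; lia.
(* If all [x - c] are units, [p] is trivial on K(x), and the terms of a relation for a uniformizer
   [h] over K(x) have the distinct valuations [j]. *)
have [hx|] := pselect (forall c, x - const C c != 0 /\ p (x - const C c) = 0).
  have [h h0 ph] := val_uniformizer p.
  have [n [u [[i ui] s0]]] := alg h.
  have := sum_distinct_val (p := p) _ s0 => /(_ _ i) => H.
  have /eqP : (map_poly (const C) (u i)).[x] * h ^+ i = 0.
    apply: H => j k; rewrite !mulf_eq0 !negb_or => /andP[a0 b0] /andP[c0 d0].
    rewrite !valM // !valX ph.
    have uj w : (map_poly (const C) w).[x] != 0 -> w != 0 by apply: contraNneq => ->; rewrite rmorph0 horner0.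
    rewrite (unit_of x hx _ (uj _ a0)).2 (unit_of x hx _ (uj _ c0)).2 !add0r !pmulrn !intz.
    by case=> e; apply: val_inj.
  by rewrite mulf_eq0 expf_eq0 (negbTE h0) andbF orbF (negbTE (tr _ ui)).
move=> /existsNP [c hc].
have xc0 : x - const C c != 0.
  by have := tr _ (negbT (polyXsubC_eq0 c)); rewrite map_polyXsubC hornerXsubC.
(* The relation between [f] and [x] is rearranged by powers of [z]. Its coefficients are polynomials
   in [f], hence zero or units, while the powers of [z] have distinct valuations. *)
pose z := x - const C c; have pz : p z != 0 by apply: contra_notN hc => /eqP.
have [n [u [[i0 ui] s0]]] := alg f.
pose w j := u j \Po ('X + c%:P).
have wE j : (map_poly (const C) (u j)).[x] = (map_poly (const C) (w j)).[z].
  rewrite /w map_comp_poly /= horner_comp rmorphD /= map_polyX map_polyC /= hornerD hornerX hornerC.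
  by rewrite /z subrK.
pose N := \max_j size (w j).
pose a (i : 'I_N) := \poly_(j < n) (if insub j is Some j' then (w j')`_i else 0).
have s1 : \sum_(i < N) (map_poly (const C) (a i)).[f] * z ^+ i = 0.
  rewrite -[RHS]s0; under [RHS]eq_bigr => j _.
    rewrite wE (@horner_coef_wide _ N); last first.
      by rewrite size_map_poly; apply: (leq_bigmax j).
    rewrite mulr_suml; over.
  rewrite exchange_big; apply: eq_bigr => i _ /=.
  rewrite (@horner_coef_wide _ n); last by rewrite size_map_poly size_poly.
  rewrite mulr_suml; apply: eq_bigr => j _.
  rewrite !coef_map /= coef_poly ltn_ord valK /=; ring.
have z0 : z != 0 by [].
have H i : (map_poly (const C) (a i)).[f] * z ^+ i = 0.
  apply: (sum_distinct_val (p := p) _ s1) => j k.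
  rewrite !mulf_eq0 !negb_or => /andP[a0 b0] /andP[c0 d0].
  have uj w' : (map_poly (const C) w').[f] != 0 -> w' != 0 by apply: contraNneq => ->; rewrite rmorph0 horner0.
  rewrite !valM // !valX (unit_of f hf _ (uj _ a0)).2 (unit_of f hf _ (uj _ c0)).2 !add0r.
  by move=> /(mulrIn pz) e; apply: val_inj.
have w0 : w i0 != 0.
  apply: contraNneq (tr _ ui) => e; by rewrite wE e rmorph0 horner0.
have lN : ((size (w i0)).-1 < N)%N.
  by apply: leq_trans (leq_bigmax i0); rewrite prednK // size_poly_gt0.
have /eqP := H (Ordinal lN); rewrite mulf_eq0 expf_eq0 (negbTE z0) andbF orbF.
suff a0 : a (Ordinal lN) != 0 by rewrite (negbTE (unit_of f hf _ a0).1).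
apply: contraNneq w0 => /polyP/(_ i0); rewrite coef0 coef_poly ltn_ord valK /=.
by move=> /eqP; rewrite lead_coef_eq0.
Qed.

(** As the residue field is [K], the functions of order at least [k] modulo those of order at least
    [k + 1] form a line, spanned by [g]. *)
Lemma residue_ratio (p : place C) (k : int) (f g : C) :
  vge p k f -> g != 0 -> p g = k -> exists c : K, vge p (k + 1) (f - const C c * g).
Proof.
move=> vf g0 pg.
have [|c hc] := @residue p (f / g).
  by have := vgeM vf (_ : vge p (- k) g^-1); rewrite subrr; apply; rewrite vgeE ?invr_eq0 // valV pg.
exists c; have -> : f - const C c * g = (f / g - const C c) * g by field.
by rewrite addrC vgeM // vgeE // pg.
Qed.

End Residue.

(** * Riemann spaces *)

Section Dimension.
Variables (K : closedFieldType) (C : curve K) (V : lmodType C).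
Implicit Types (Q : V -> Prop) (n : nat).

(** Independence is over [K], although [V] is a module over the function field. With [V := C^o] this
    is [riemann_dim_ge]; with polynomials it measures spaces of sections. *)
Definition dim_ge Q n : Prop :=
  exists e : 'I_n -> V,
    (forall i, Q (e i)) /\
    (forall c : 'I_n -> K, \sum_(i < n) const C (c i) *: e i = 0 -> forall i, c i = 0).

Definition ksubspace Q : Prop := forall (c : K) u v, Q u -> Q v -> Q (u - const C c *: v).

Lemma dim_geS Q n : dim_ge Q n.+1 -> dim_ge Q n.
Proof.
move=> [e [Qe ind]]; exists (fun i => e (lift ord0 i)); split=> // c s0 i.
have := ind (fun k => if unlift ord0 k is Some i then c i else 0) _ (lift ord0 i).
rewrite liftK; apply; rewrite (bigD1_ord ord0) //= unlift_none rmorph0 scale0r add0r -[RHS]s0.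
by apply: eq_bigr => j _; rewrite liftK.
Qed.

Lemma dim_geW Q m n : (m <= n)%N -> dim_ge Q n -> dim_ge Q m.
Proof.
elim: n => [|n IH]; first by rewrite leqn0 => /eqP->.
by rewrite leq_eqVlt => /predU1P[->//|mn] /dim_geS; apply: IH.
Qed.

Lemma dim_ge_sub Q Q' n : (forall u, Q u -> Q' u) -> dim_ge Q n -> dim_ge Q' n.
Proof. by move=> QQ' [e [Qe ind]]; exists e; split=> // i; apply: QQ'. Qed.

Lemma dim_ge1 Q : dim_ge Q 1 -> exists2 u, u != 0 & Q u.
Proof.
move=> [e [Qe ind]]; exists (e ord0) => //; apply/eqP => e0.
have s0 : \sum_(i < 1) const C 1 *: e i = 0 by rewrite big_ord1 e0 scaler0.
by have /eqP := ind (fun=> 1) s0 ord0; rewrite oner_eq0.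
Qed.

(** If the whole family lies in [Q'], one vector is dropped; otherwise a vector outside [Q'] serves
    as a pivot to push the others into [Q']. *)
Lemma dim_ge_codim1 Q Q' n :
  (forall u v, Q u -> Q v -> Q' v \/ exists c, Q' (u - const C c *: v)) ->
  dim_ge Q n.+1 -> dim_ge Q' n.
Proof.
move=> QQ' [e [Qe ind]].
have [Q'e|/existsNP [j nQj]] := pselect (forall i, Q' (e i)).
  by apply: dim_geS; exists e.
have /boolp.choice [b hb] : forall i : 'I_n, exists c, Q' (e (lift j i) - const C c *: e j).
  by move=> i; have [] := QQ' _ _ (Qe (lift j i)) (Qe j).
exists (fun i => e (lift j i) - const C (b i) *: e j); split=> // c s0 i.
have := ind (fun k => if unlift j k is Some i then c i else - \sum_i c i * b i) _ (lift j i).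
rewrite liftK; apply; rewrite (bigD1_ord j) //= unlift_none -[RHS]s0.
rewrite rmorphN rmorph_sum scaleNr scaler_suml -sumrN -big_split; apply: eq_bigr => k _ /=.
by rewrite liftK scalerBr scalerA -rmorphM addrC.
Qed.

Lemma dim_ge_val (p : place C) (k : int) (phi : V -> C) Q n :
  ksubspace Q ->
  (forall c u v, phi (u - const C c *: v) = phi u - const C c * phi v) ->
  (forall u, Q u -> vge p k (phi u)) ->
  dim_ge Q n.+1 -> dim_ge (fun u => Q u /\ vge p (k + 1) (phi u)) n.
Proof.
move=> sQ lin Qk; apply: dim_ge_codim1 => u v Qu Qv.
have [h|h] := boolP (vge p (k + 1) (phi v)); [by left | right].
move: h; rewrite /vge negb_or => /andP [v0 hv].
have [|c hc] := residue_ratio (Qk _ Qu) v0.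
  by move: (Qk _ Qv); rewrite vgeE //; lia.
by exists c; split; [apply: sQ | rewrite lin].
Qed.

End Dimension.

Section RiemannSpaces.
Variables (K : closedFieldType) (C : curve K).
Implicit Types (A B D : divisor C) (p q : place C) (f g h : C) (n : nat).

Lemma riemann_ksubspace A : @ksubspace _ C C^o (riemann_space A).
Proof. by move=> c u v Au Av p; apply: vgeB; rewrite ?vgeZ. Qed.

Lemma coeff_pt p q : coeff p (<< q >> : divisor C) = (q == p)%:R.
Proof. by rewrite coeffU mul1r. Qed.

Lemma riemann_dimB A p n : riemann_dim_ge A n.+1 -> riemann_dim_ge (A - << p >>) n.
Proof.
move=> h; pose Q' f := riemann_space A f /\ vge p (- coeff p A + 1) f.
have : @dim_ge _ C C^o Q' n.
  apply: (@dim_ge_val _ C C^o p (- coeff p A) id (riemann_space A)) => //.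
  exact: riemann_ksubspace.
apply: dim_ge_sub => f [Af pf] x; rewrite coeffB coeff_pt.
have [<-|px] := eqVneq p x; first by apply: vgeW pf; lia.
by rewrite subr0.
Qed.

Lemma riemann_dim_pts A (s : seq (place C)) n :
  riemann_dim_ge A (n + size s) -> riemann_dim_ge (A - \sum_(p <- s) << p >>) n.
Proof.
elim: s A => [|p s IH] A /=; first by rewrite big_nil subr0 addn0.
by rewrite addnS big_cons opprD addrA => /riemann_dimB => h; apply: IH.
Qed.

Lemma riemann_dimW A m n : (m <= n)%N -> riemann_dim_ge A n -> riemann_dim_ge A m.
Proof. exact: (@dim_geW _ C C^o). Qed.

Lemma riemann_dim0 A : riemann_dim_ge A 0.
Proof. by exists (fun _ => 0); split=> [[]|c _ []]. Qed.

Lemma riemann_dim_le A B n :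
  (forall p, coeff p A <= coeff p B) -> riemann_dim_ge A n -> riemann_dim_ge B n.
Proof.
move=> AB; apply: (@dim_ge_sub _ C C^o) => f Af p; apply: vgeW (Af p); by rewrite lerN2.
Qed.

Lemma riemann_dim_mul A B h n : h != 0 ->
  (forall f, riemann_space A f -> riemann_space B (h * f)) ->
  riemann_dim_ge A n -> riemann_dim_ge B n.
Proof.
move=> h0 hAB [e [Ae ind]]; exists (fun i => h * e i); split => [i|c s0].
  exact: hAB.
apply: ind; apply: (mulfI h0); rewrite mulr0 -[RHS]s0 mulr_sumr.
by apply: eq_bigr => i _; rewrite mulrCA.
Qed.

Lemma riemann_dim_distinct p A n (e : 'I_n -> C) :
  (forall i, e i != 0) -> injective (fun i => p (e i)) ->
  (forall i, riemann_space A (e i)) -> riemann_dim_ge A n.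
Proof.
move=> e0 inj Ae; exists e; split=> // c s0 i.
have h : const C (c i) * e i = 0.
  apply: (sum_distinct_val (p := p) _ s0) => j k.
  rewrite !mulf_eq0 !negb_or !fmorph_eq0 => /andP[cj ej] /andP[ck ek].
  by rewrite !valM ?fmorph_eq0 // !val_const // !add0r => /inj.
by apply/eqP; move/eqP: h; rewrite mulf_eq0 fmorph_eq0 (negbTE (e0 i)) orbF.
Qed.

Lemma const_riemann_dim A :
  (forall f, riemann_space A f -> exists c, f = const C c) -> ~ riemann_dim_ge A 2.
Proof.
move=> cst [e [Ae ind]].
have [c0 h0] := cst _ (Ae ord0); have [c1 h1] := cst _ (Ae (lift ord0 ord0)).
have ind' a b : a * c0 + b * c1 = 0 -> a = 0 /\ b = 0.
  move=> ab0; pose c (i : 'I_2) := if i == ord0 then a else b.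
  have s0 : \sum_(i < 2) const C (c i) * e i = 0.
    by rewrite big_ord_recl big_ord1 h0 h1 /c /= -!rmorphM -rmorphD ab0 rmorph0.
  by split; [exact: (ind c s0 ord0) | exact: (ind c s0 (lift ord0 ord0))].
have [_ /eqP] := ind' c1 (- c0) ltac:(ring).
rewrite oppr_eq0 => /eqP c00; have := (ind' 1 0); rewrite c00 => /(_ ltac:(ring)) [/eqP].
by rewrite oner_eq0.
Qed.

Lemma coeff_pts p (s : seq (place C)) :
  coeff p (\sum_(x <- s) << x >> : divisor C) = (count_mem p s)%:Z.
Proof.
elim: s => [|x s IH]; first by rewrite big_nil coeff0.
by rewrite big_cons coeffD coeff_pt IH /= PoszD; case: (x == p).
Qed.

Lemma deg_pts (s : seq (place C)) : deg (\sum_(x <- s) << x >> : divisor C) = (size s)%:Z.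
Proof.
elim: s => [|x s IH]; first by rewrite big_nil deg0.
by rewrite big_cons degD degU IH /= -add1n PoszD.
Qed.

Lemma effective_pts B : (forall p, 0 <= coeff p B) ->
  exists s : seq (place C), B = \sum_(x <- s) << x >>.
Proof.
move=> B0; exists (flatten [seq nseq `|coeff z B|%N z | z <- dom B]).
rewrite big_flatten big_map -{1}(freeg_sumE B); apply: eq_bigr => z _.
rewrite big_nseq iter_addr_0 freegU_muln; congr << _ *g _ >>.
by have := B0 z; rewrite natz; lia.
Qed.

Lemma pts_ge A B : exists s : seq (place C), forall p,
  coeff p A <= coeff p (B + \sum_(x <- s) << x >>).
Proof.
have [|s hs] := @effective_pts (fgpos (A - B)).
  by move=> p; rewrite coeff_fgposE le_max lexx.
exists s => p; by rewrite -hs coeffD coeff_fgposE coeffB -lerBlDl le_max lexx orbT.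
Qed.

End RiemannSpaces.

(** * Curves of genus one *)

Section GenusOne.
Variables (K : closedFieldType) (C : curve K).
Hypothesis genus1 : has_genus C 1.
Implicit Types (A B D : divisor C) (p q : place C) (f g h : C) (n : nat).

(** The definition of the genus speaks only of finite dimensions. Adding points to [A0] makes it
    exceed [A], and removing them costs finitely many dimensions, so an infinite L(A) would make
    L(A0) infinite. *)
Lemma riemann_dim_exists A : exists n, riemann_dim A n.
Proof.
have [_ [A0 [n0 [[_ n0max] _]]]] := genus1.
have [s hs] := pts_ge A A0.
apply: contrapT => /forallNP no.
have all_ge n : riemann_dim_ge A n.
  elim: n => [|n IH]; first exact: riemann_dim0.
  by apply: contrapT => nge; apply: (no n).
apply: n0max; rewrite -[A0](addrK (\sum_(x <- s) << x >>)); apply: riemann_dim_pts.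
exact: riemann_dim_le hs (all_ge _).
Qed.

Lemma riemann_inequality A n : n%:Z <= deg A -> riemann_dim_ge A n.
Proof.
move=> nA; have [m hm] := riemann_dim_exists A.
have := genus1.1 A m hm; move=> le; apply: riemann_dimW hm.1; lia.
Qed.

(* This replaces the formula deg (div f) = 0: multiplication by f embeds L(A) in
   L(A + B), whose dimension is smaller when deg A is large. *)
Lemma riemann_space_neg B f : deg B < 0 -> riemann_space B f -> f = 0.
Proof.
move=> B0 Bf; apply/eqP/negPn/negP => f0.
have [_ [A0 [n0 [[_ n0max] degA0]]]] := genus1.
have [s hs] := pts_ge 0 B.
have [p|t ht] := @effective_pts _ _ (B + \sum_(x <- s) << x >>).
  by rewrite -(coeff0 _ p).
have size_t : (size t < size s)%N.
  by have := congr1 (@deg _) ht; rewrite degD !deg_pts; lia.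
apply: n0max; apply: (@riemann_dimW _ _ _ _ (n0 + (size s - size t))); first by lia.
rewrite -[A0](addrK (\sum_(x <- t) << x >>)); apply: riemann_dim_pts.
rewrite -addnA subnK; last exact: ltnW.
apply: (riemann_dim_mul f0 (A := A0 + \sum_(x <- s) << x >>)); last first.
  by apply: riemann_inequality; rewrite degD deg_pts; lia.
move=> g Ag p; have := vgeM (Bf p) (Ag p).
by rewrite -ht !coeffD; congr (vge _ _ _); ring.
Qed.

(* Pic^0 is the set of the classes of p - q: a section of a line bundle of degree
   one vanishes at a single point. *)
Lemma degree_one A : deg A = 1 ->
  exists (h : C) (p : place C), h != 0 /\ forall x : place C, x h = coeff x << p >> - coeff x A.
Proof.
move=> A1; have [|h h0 Ah] := @dim_ge1 _ C C^o (riemann_space A).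
  by apply: riemann_inequality; rewrite A1.
have Ah' x : - coeff x A <= x h by have := Ah x; rewrite vgeE.
(* Where [h] vanishes more than [B] requires, a point can be subtracted from [B]. This happens at
   least once, as otherwise [h^-1] would lie in L(-A), and at most once, as the degree would become
   negative. *)
have step B p : (forall x, - coeff x B <= x h) -> p h != - coeff p B ->
    forall x, - coeff x (B - << p >>) <= x h.
  move=> Bh ne x; rewrite coeffB coeff_pt; have [<-|] := eqVneq p x; last by rewrite subr0.
  have := Bh p; rewrite le_eqVlt eq_sym (negbTE ne) /=; lia.
have sp B : (forall x, - coeff x B <= x h) -> ~ (deg B < 0).
  move=> Bh B0; move: h0; rewrite (@riemann_space_neg B h) ?eqxx //.
  by move=> x; rewrite /vge Bh orbT.
exists h; have [all_eq|/existsNP [p /eqP ne]] := pselect (forall x : place C, x h = - coeff x A).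
  have : h^-1 = 0.
    apply: (@riemann_space_neg (- A)); first by rewrite degN A1.
    by move=> x; rewrite /vge valV all_eq coeffN lexx orbT.
  by move/eqP; rewrite invr_eq0 (negbTE h0).
exists p; split=> // x; have hp := step _ _ Ah' ne.
have [->|ne'] := eqVneq (x h) (- coeff x (A - << p >>)); first by rewrite coeffB opprB.
by case: (sp _ (step _ _ hp ne')); rewrite !degB !degU A1.
Qed.

(* The powers of a function f with a single simple pole at q would span a subspace
   of L(kq) of dimension k + 1, but dim L(kq) = k for large k. *)
Lemma simple_pole_const q f : riemann_space << q >> f -> exists c, f = const C c.
Proof.
move=> qf; have [qf0|qf0] := boolP (vge q 0 f).
  have [c hc] := residue qf0; exists c; apply/eqP; rewrite -subr_eq0; apply/eqP.
  apply: (@riemann_space_neg (- << q >>)); first by rewrite degN degU.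
  move=> x; rewrite coeffN coeff_pt opprK; have [<-//|xq] := eqVneq q x.
  by apply: vgeB => //; have := qf x; rewrite coeff_pt (negbTE xq).
exfalso; have f0 : f != 0 by apply: contraNneq qf0 => ->.
have vf : q f = -1.
  by move: qf0 (qf q); rewrite coeff_pt eqxx !vgeE //; lia.
have [_ [A0 [n0 [[_ n0max] degA0]]]] := genus1.
(* Here deg A0 = n0, so kq - A0 has degree one and kq ~ A0 + p. Then dim L(kq) > k forces dim L(A0)
   >= k > n0. *)
pose k := n0.+1.
have [|h [p [h0 hp]]] := @degree_one (<< k%:Z *g q >> - A0).
  by rewrite degB degU /k; lia.
apply: n0max; rewrite -[A0](addrK << p >>); apply: riemann_dimB.
have hV : h^-1 != 0 by rewrite invr_eq0.
apply: (riemann_dim_mul hV (A := << k%:Z *g q >>)) => [g kg x|].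
  have hx : vge x (- x h) h^-1 by rewrite /vge valV lexx orbT.
  have := vgeM hx (kg x); rewrite hp coeffB coeffD; congr (vge _ _ _); ring.
apply: (@riemann_dim_distinct _ _ q _ _ (fun i : 'I_k.+1 => f ^+ i)).
- by move=> i; rewrite expf_neq0.
- by move=> i j /=; rewrite !valX vf => /(mulrIn (x := -1)) e; apply: val_inj; apply: e.
- move=> i x; rewrite coeffU /=; have := vgeX i (qf x); apply: vgeW.
  rewrite coeff_pt; have := ltn_ord i; rewrite ltnS; case: (q == x) => /=; rewrite ?mulr0 ?oppr0 ?mul0rn ?mulr1 //.
  by rewrite mulNrn natz => ik; rewrite lerN2.
Qed.

Lemma simple_pole_dim q : ~ riemann_dim_ge << q >> 2.
Proof. by apply: const_riemann_dim => f; apply: simple_pole_const. Qed.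

(** Otherwise L((n+1)p + q) = L(np + q); the former has dimension at least n + 2, and removing n
    times the point p would leave two independent functions in L(q). *)
Lemma exact_pole p q n : exists w : C, [/\ w != 0,
  riemann_space (<< n.+1%:Z *g p >> + << q >>) w &
  p w = - coeff p (<< n.+1%:Z *g p >> + << q >>)].
Proof.
apply: contrapT => /forallNP no; apply: (@simple_pole_dim q).
have -> : << q >> = << n%:Z *g p >> + << q >> - \sum_(x <- nseq n p) << x >> :> divisor C.
  by rewrite big_nseq iter_addr_0 freegU_muln natz addrAC subrr add0r.
apply: riemann_dim_pts; rewrite size_nseq.
have h := @riemann_inequality (<< n.+1%:Z *g p >> + << q >>) n.+2.
apply: (@dim_ge_sub _ C C^o) (h _); last by rewrite degD !degU; lia.
move=> w Aw x; have [->|w0] := eqVneq w 0; first exact: vge0.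
have := Aw x; rewrite !vgeE // !coeffD !coeffU; have [<-|_ //] := eqVneq p x.
have := no w; rewrite !coeffD !coeffU eqxx => ne le.
have {}ne : p w <> - (n.+1%:Z * 1%:R + 1 * (q == p)%:R).
  by move=> e; apply: ne; split.
by case: (q == p) ne le {no}; rewrite /= ?mulr1 ?mulr0 => ne le; lia.
Qed.

(** The polar parts are removed one order at a time: a multiple of a function with an exact pole
    cancels the leading term at one place and adds only poles that the rest of the list permits. *)
Lemma approximation_pts q (s : seq (place C)) (r : place C -> C) :
  (forall p, vge p (- coeff p (\sum_(x <- s) << x >> + << q >>)) (r p)) ->
  exists w, forall p, vge p (- coeff p << q >>) (w - r p).
Proof.
elim: s r => [|p s IH] r hr.
  by exists 0 => p; rewrite sub0r vgeN; have := hr p; rewrite big_nil add0r.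
have [w0 [w00 Aw0 pw0]] := exact_pole p q (count_mem p s).
have [|c hc] := residue_ratio _ w00 pw0 (f := r p).
  have := hr p; rewrite big_cons !coeffD coeff_pts !coeffU eqxx.
  by congr (vge _ _ _); lia.
have [x|w hw] := IH (fun x => r x - const C c * w0); last first.
  exists (w + const C c * w0) => x; have := hw x; congr (vge _ _ _); ring.
have [<-|px] := eqVneq p x.
  by move: hc; rewrite !coeffD coeff_pts !coeffU eqxx; congr (vge _ _ _); lia.
apply: vgeB.
  by have := hr x; rewrite big_cons -addrA coeffD coeff_pt (negbTE px) add0r.
apply: vgeZ; apply: vgeW (Aw0 x); rewrite !coeffD coeff_pts !coeffU (negbTE px); lia.
Qed.

(* H^1(E, O(q)) = 0, for an adele r. *)
Lemma approximation q (r : place C -> C) :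
  (exists s : seq (place C), forall p, p \notin s -> vge p 0 (r p)) ->
  exists w, forall p, vge p (- coeff p << q >>) (w - r p).
Proof.
move=> [s hs].
have [t ht] : exists t : seq (place C), forall p, p \in s -> vge p (- (count_mem p t)%:Z) (r p).
  elim: s {hs} => [|x s [t ht]]; first by exists [::].
  exists (nseq `|x (r x)|%N x ++ t) => p; rewrite inE count_cat count_nseq /=.
  have [->|px] := eqVneq p x; first by move=> _; have [->//|rx0] := eqVneq (r x) 0; rewrite vgeE //; lia.
  by rewrite orFb => /ht; rewrite mul0n add0n.
apply: (@approximation_pts q t) => p; rewrite coeffD coeff_pts coeff_pt.
have [/ht|/hs] := boolP (p \in s); apply: vgeW; lia.
Qed.

End GenusOne.

(** * Sections of multiplicity three *)

Section CoefficientValuation.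
Variables (K : closedFieldType) (C : curve K) (p : place C).
Implicit Types (g h b : {poly C}) (n m : int).

(** The Gauss extension of the valuation to polynomials; for [n = 0] it is [chart_ring]. *)
Definition pvge n h : Prop := forall i : nat, vge p n h`_i.

Lemma pvge0 n : pvge n 0.
Proof. by move=> i; rewrite coef0. Qed.

Lemma pvgeD n g h : pvge n g -> pvge n h -> pvge n (g + h).
Proof. by move=> ng nh i; rewrite coefD vgeD. Qed.

Lemma pvgeC n (a : C) : vge p n a -> pvge n a%:P.
Proof. by move=> na i; rewrite coefC; case: (i == 0)%N. Qed.

Lemma pvgeX : pvge 0 'X.
Proof. by move=> i; rewrite coefX; case: (i == 1)%N. Qed.

Lemma pvgeM n m g h : pvge n g -> pvge m h -> pvge (n + m) (g * h).
Proof. by move=> ng mh i; rewrite coefM; apply: vge_sum => j _; apply: vgeM. Qed.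

Lemma pvgeZ n m (a : C) h : vge p n a -> pvge m h -> pvge (n + m) (a *: h).
Proof. by move=> na mh; rewrite -mul_polyC; apply: pvgeM => //; apply: pvgeC. Qed.

Lemma pvgeX0 h k : pvge 0 h -> pvge 0 (h ^+ k).
Proof.
move=> h0; elim: k => [|k IH]; first by rewrite expr0 -[1]/(1%:P); apply: pvgeC.
by rewrite exprS -[0]addr0; apply: pvgeM.
Qed.

Lemma pvge_comp n g b : pvge n g -> pvge 0 b -> pvge n (g \Po b).
Proof.
move=> ng b0; rewrite comp_polyE; elim/big_ind: _ => [|x y|i _]; [exact: pvge0 | exact: pvgeD |].
by rewrite -[n]addr0; apply: pvgeZ => //; apply: pvgeX0.
Qed.

Lemma pvge_linear (a b : C) : vge p 0 a -> vge p 0 b -> pvge 0 (a *: 'X + b%:P).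
Proof.
move=> a0 b0; apply: pvgeD; last exact: pvgeC.
by rewrite -[0]addr0; apply: pvgeZ => //; apply: pvgeX.
Qed.

Lemma pvge_horner n h (a : C) : pvge n h -> vge p 0 a -> vge p n h.[a].
Proof.
move=> nh a0; rewrite horner_coef; apply: vge_sum => i _.
by rewrite -[n]addr0; apply: vgeM => //; apply: vgeX0.
Qed.

Lemma vge_hornerB g (a b : C) : pvge 0 g -> vge p 0 a -> vge p 0 b ->
  vge p 1 (a - b) -> vge p 1 (g.[a] - g.[b]).
Proof.
move=> g0 a0 b0 ab; rewrite !horner_coef -sumrB; apply: vge_sum => i _.
rewrite -mulrBr subrXX mulrCA -[1]addr0; apply: vgeM => //; apply: vgeMl => //.
by apply: vge_sum => j _; apply: vgeMl; apply: vgeX0.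
Qed.

Lemma max_ideal_XsubC (c : K) : max_ideal p c ('X - (const C c)%:P).
Proof.
split; last by rewrite !hornerE subrr.
by rewrite -polyCN -[X in X + _]scale1r; apply: pvge_linear; rewrite ?vgeN.
Qed.

Lemma ideal_pow_const (c : K) (a : C) k :
  vge p k%:Z a -> ideal_pow (chart_ring p) (max_ideal p c) k a%:P.
Proof.
have [u u0 pu] := val_uniformizer p.
elim: k a => [|k IH] a ka; first by apply: ideal_pow0; apply: pvgeC.
have -> : a%:P = u%:P * (a / u)%:P by rewrite -polyCM; congr _%:P; field.
apply: ideal_powM.
  split; first by apply: pvgeC; rewrite vgeE // pu.
  by rewrite hornerC vgeE // pu.
apply: IH; have -> : k%:Z = k.+1%:Z - 1 by lia.
by apply: (vge_divr u0 pu); rewrite divfK.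
Qed.

(** Horner's scheme in s - c: the constant term lies in the k-th power of the ideal (u), the rest is
    s - c times an element of the (k-1)-st power. *)
Lemma ideal_pow_coef (c : K) k h :
  pvge 0 h -> (forall i, (i <= k)%N -> vge p (k%:Z - i%:Z) h`_i) ->
  ideal_pow (chart_ring p) (max_ideal p c) k (h \Po ('X - (const C c)%:P)).
Proof.
elim: k h => [|k IH] h h0 hk.
  by apply: ideal_pow0; apply: pvge_comp => //; case: (max_ideal_XsubC c).
have [h' [a eh]] : exists h' a, h = h' * 'X + a%:P.
  by elim/poly_ind: h {h0 hk} => [|h a _]; [exists 0, 0; rewrite mul0r add0r | exists h, a].
have hS i : h`_i.+1 = h'`_i by rewrite eh coefD coefMX coefC addr0.
rewrite eh comp_polyD comp_polyM comp_polyX comp_polyC; apply: ideal_powD.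
  rewrite mulrC; apply: ideal_powM; first exact: max_ideal_XsubC.
  apply: IH => [i|i ik]; first by rewrite -hS.
  by rewrite -hS; apply: vgeW (hk i.+1 ik); lia.
apply: ideal_pow_const; have := hk 0 isT.
by rewrite eh coefD coefMX coefC eqxx add0r subr0.
Qed.

(* The m-th power of the maximal ideal (u, s - c) in the coordinate s - a, where
   a is any function with residue c. *)
Lemma coef_ideal_pow (c : K) (a : C) k h :
  vge p 0 a -> vge p 1 (a - const C c) ->
  ideal_pow (chart_ring p) (max_ideal p c) k h ->
  pvge 0 h /\ forall i : nat, vge p (k%:Z - i%:Z) (h \Po ('X + a%:P))`_i.
Proof.
move=> a0 ac.
have comp0 g : pvge 0 g -> pvge 0 (g \Po ('X + a%:P)).
  by move=> g0; apply: pvge_comp => //; rewrite -['X]scale1r; apply: pvge_linear.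
elim=> {k h} [h h0|k g h [g0 gc] _ [h0 hk]|k g h _ [g0 gk] _ [h0 hk]].
- by split=> // i; apply: vgeW (comp0 _ h0 i); lia.
- split; first by rewrite -[0]addr0; apply: pvgeM.
  move=> i; rewrite comp_polyM coefM; apply: vge_sum => -[[|j] /= ji] _.
    have -> : k.+1%:Z - i%:Z = 1 + (k%:Z - (i - 0)%N%:Z) by lia.
    apply: vgeM => //; rewrite -horner_coef0 horner_comp !hornerE.
    by rewrite -[g.[a]](subrK g.[const C c]); apply: vgeD => //; apply: vge_hornerB.
  apply: vgeW (vgeMl (comp0 _ g0 j.+1) (hk _)); lia.
- by split=> [|i]; [apply: pvgeD | rewrite comp_polyD coefD vgeD].
Qed.

End CoefficientValuation.

(** * The upper bound *)

Section UpperBound.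
Variables (K : closedFieldType) (S : atiyah_surface K).
Hypothesis genus1 : has_genus (base S) 1.
Implicit Types (g h : {poly base S}) (p : place (base S)).
Local Notation q := (basept S).

Lemma local_formD p g h : local_form p (g + h) = local_form p g + local_form p h.
Proof. exact: comp_polyD. Qed.

Lemma local_formZ p (a : base S) g : local_form p (a *: g) = a *: local_form p g.
Proof. exact: comp_polyZ. Qed.

Lemma local_formB p (a : base S) g h :
  local_form p (g - a *: h) = local_form p g - a *: local_form p h.
Proof. by rewrite /local_form comp_polyB comp_polyZ. Qed.

Lemma size_local_form p g : size (local_form p g) = size g.
Proof. by rewrite size_comp_poly2 // size_XaddC. Qed.

Lemma local_formXn p k : local_form p 'X^k = ('X + (bundle S p)%:P) ^+ k.
Proof. by rewrite /local_form comp_Xn_poly. Qed.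

Lemma coef_local_formXn p k : (local_form p 'X^k)`_k = 1.
Proof.
have := monic_exp k (monicXaddC (bundle S p)).
by rewrite -local_formXn monicE /lead_coef size_local_form size_polyXn => /eqP.
Qed.

(* The coefficients of a section are found from the leading one downwards: each of
   them solves an approximation problem, as H^1(E, O(q)) = 0. *)
Lemma monic_section l : exists g, g \is monic /\ size g = l.+1 /\ section l g.
Proof.
(* The finite set of exceptional places is carried along because the next coefficient has to be an
   adele for [approximation]. *)
suff H j : (j <= l)%N -> exists g, [/\ g \is monic, size g = l.+1,
    forall p i, (l - j <= i)%N -> vge p (- coeff p << q >>) (local_form p g)`_i &
    exists s : seq (place (base S)), forall p, p \notin s -> pvge p 0 (local_form p g)].
  have [g [gm gs gl _]] := H l (leqnn l); exists g; split=> //; split=> //; split; first by rewrite gs.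
  by move=> p i; apply: gl; rewrite subnn.
have [s hs] := ext_finite (bundle S).
have Xint p k : p \notin s -> pvge p 0 (local_form p 'X^k).
  move=> ps; rewrite local_formXn; apply: pvgeX0; rewrite -['X]scale1r.
  by apply: pvge_linear => //; apply: hs.
have ge0 p : 0 <= coeff p (<< q >> : divisor (base S)) by rewrite coeff_pt.
elim: j => [_|j IH jl].
  exists 'X^l; rewrite monicXn size_polyXn; split=> //; last by exists s => p; apply: Xint.
  move=> p i; rewrite subn0 leq_eqVlt => /predU1P[<-|li].
    by rewrite coef_local_formXn; apply: vgeW (vge1 p); rewrite oppr_le0.
  by rewrite nth_default ?vge0 // size_local_form size_polyXn.
have [g [gm gs gl [t ht]]] := IH (ltnW jl).
pose i0 := (l - j.+1)%N.
have [|w hw] := @approximation _ _ genus1 q (fun p => - (local_form p g)`_i0).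
  by exists t => p /ht /(_ i0); rewrite vgeN.
have i0l : (size (w *: 'X^i0) < size g)%N.
  by apply: leq_ltn_trans (size_scale_leq _ _) _; rewrite size_polyXn gs /i0; lia.
exists (g + w *: 'X^i0); split.
- by rewrite monicE lead_coefDl.
- by rewrite size_polyDl.
- move=> p i; rewrite leq_eqVlt => /predU1P[<-|li].
    rewrite local_formD local_formZ coefD coefZ coef_local_formXn mulr1.
    by have := hw p; rewrite opprK addrC.
  rewrite local_formD local_formZ coefD coefZ [X in _ + _ * X]nth_default ?mulr0 ?addr0.
    by apply: gl; lia.
  by rewrite size_local_form size_polyXn.
- exists (q :: t ++ s) => p; rewrite in_cons mem_cat negb_or => /andP[pq]; rewrite negb_or => /andP[pt ps].
  rewrite local_formD local_formZ; apply: pvgeD; first exact: ht.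
  rewrite -[0]addr0; apply: pvgeZ; last exact: Xint.
  have := hw p; rewrite coeff_pt eq_sym (negbTE pq) opprK oppr0 => h.
  by rewrite -[w](addrK (local_form p g)`_i0); apply: vgeB => //; apply: ht.
Qed.

Lemma sections_dim l : @dim_ge _ _ {poly base S} (section l) l.+1.
Proof.
have /boolp.choice [e he] := monic_section.
exists (fun i => e i); split=> [i|c s0].
  have [_ [si [_ sl]]] := he i; split=> //.
  by rewrite si.
suff H k (i : 'I_l.+1) : (l - i <= k)%N -> c i = 0 by move=> i; apply: (H l); apply: leq_subr.
elim: k i => [|k IH] i hi.
all: have /polyP/(_ i) := s0; rewrite coef_sum (bigD1 i) //= big1 ?addr0.
1,3: have [em [es _]] := he i; move/monicP: em; rewrite /lead_coef es coefZ coef0 => -> /eqP.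
1,2: by rewrite mulr1 fmorph_eq0 => /eqP.
all: move=> j ji; rewrite coefZ; have [_ [es _]] := he j.
all: have [lt|gt|/val_inj e'] := ltngtP j i; last by rewrite e' eqxx in ji.
1,3: by rewrite nth_default ?mulr0 // es.
  by have := ltn_ord j; lia.
by rewrite IH ?rmorph0 ?mul0r //; lia.
Qed.

(* Multiplicity 3 at x is given by 6 linear conditions on the 7-dimensional space
   of sections. *)
Theorem has_curve_6 (x : affine_point S) : has_curve 3 x 6.
Proof.
case: x => p c; have [w w0 pw] := val_uniformizer p.
have [u [u0 pu]] : exists u : base S, u != 0 /\ p u = coeff p << q >>.
  rewrite coeff_pt; case: (q == p); first by exists w.
  by exists 1; rewrite oner_neq0 val1.
pose phi i g : base S := (u%:P * local_form p g \Po ('X + (const (base S) c)%:P))`_i.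
have lin i b g h : phi i (g - const _ b *: h) = phi i g - const _ b * phi i h.
  rewrite /phi local_formB mulrBr -scalerAr comp_polyB comp_polyZ coefB coefZ //.
have int g : section 6 g -> pvge p 0 (u%:P * local_form p g).
  move=> [_ sg] i; have := vgeM (_ : vge p (coeff p << q >>) u) (sg p i).
  by rewrite subrr coefCM; apply; rewrite vgeE // pu.
have phi0 i g : section 6 g -> vge p 0 (phi i g).
  move=> sg; apply: pvge_comp (int _ sg) _ i.
  by rewrite -['X]scale1r; apply: pvge_linear.
(* The triple gives the orders imposed on the coefficients of 1, s - c and (s - c)^2. Multiplicity 3
   is (3, 2, 1), reached from (0, 0, 0) in six steps of one condition each. *)
pose Q (k : nat * nat * nat) g := [/\ section 6 g, vge p k.1.1%:Z (phi 0 g),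
   vge p k.1.2%:Z (phi 1 g) & vge p k.2%:Z (phi 2 g)].
have subQ k : ksubspace (Q k).
  move=> b g h [g0 g1 g2 g3] [h0 h1 h2 h3]; split; rewrite ?lin ?vgeB ?vgeZ //.
  have [gs gl] := g0; have [hs hl] := h0; split.
    apply: leq_trans (size_polyD _ _) _; rewrite geq_max gs size_polyN.
    exact: leq_trans (size_scale_leq _ _) hs.
  by move=> x i; rewrite local_formB coefB coefZ; apply: vgeB => //; apply: vgeZ.
have dim7 : dim_ge (Q (0, 0, 0)) 7.
  apply: dim_ge_sub (sections_dim 6) => g sg; split=> //; exact: phi0.
have step0 a b d n : dim_ge (Q (a, b, d)) n.+1 -> dim_ge (Q (a.+1, b, d)) n.
  move/(dim_ge_val (p := p) (k := a) (phi := phi 0) (subQ _) (lin 0)) => h.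
  by apply: dim_ge_sub (h _) => [g [[? ? ? ?] ?]|g []] //; split=> //=; rewrite -addn1 PoszD.
have step1 a b d n : dim_ge (Q (a, b, d)) n.+1 -> dim_ge (Q (a, b.+1, d)) n.
  move/(dim_ge_val (p := p) (k := b) (phi := phi 1) (subQ _) (lin 1)) => h.
  by apply: dim_ge_sub (h _) => [g [[? ? ? ?] ?]|g []] //; split=> //=; rewrite -addn1 PoszD.
have step2 a b d n : dim_ge (Q (a, b, d)) n.+1 -> dim_ge (Q (a, b, d.+1)) n.
  move/(dim_ge_val (p := p) (k := d) (phi := phi 2) (subQ _) (lin 2)) => h.
  by apply: dim_ge_sub (h _) => [g [[? ? ? ?] ?]|g []] //; split=> //=; rewrite -addn1 PoszD.
have [g g0 [sg h0 h1 h2]] := dim_ge1 (step2 _ _ _ _ (step1 _ _ _ _ (step1 _ _ _ _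
  (step0 _ _ _ _ (step0 _ _ _ _ (step0 _ _ _ _ dim7)))))).
exists g; split=> //; exists u; split=> //; exists 1; split.
- by rewrite -[1]/(1%:P); apply: pvgeC.
- move=> [_]; rewrite hornerC vgeE ?oner_neq0 // val1 //.
- rewrite mul1r.
  have -> : u%:P * local_form p g =
      (u%:P * local_form p g \Po ('X + (const (base S) c)%:P)) \Po ('X - (const (base S) c)%:P).
    by rewrite comp_polyXaddC_K.
  apply: ideal_pow_coef => [i|i]; first exact: phi0.
  by case: i => [|[|[|[|]]]] // _; apply: phi0.
Qed.

Lemma lambda0_at (x : affine_point S) (D : divisor (base S)) :
  lin_equiv (<< x.1 >> - << q >>) D -> exists k, lambda0 3 D k.
Proof.
move=> xD; have ex : exists n, `[< has_curve 3 x n >] by exists 6; apply/asboolP/has_curve_6.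
case: (ex_minnP ex) => k /asboolP hk kmin; exists k, x; split=> // l hl.
by apply: kmin; apply/asboolP.
Qed.

Lemma lambda0_exists (D : divisor (base S)) : deg D = 0 -> exists k, lambda0 3 D k.
Proof.
move=> D0; have [|h [p [h0 hp]]] := degree_one genus1 (A := D + << q >>).
  by rewrite degD degU D0.
apply: (@lambda0_at (p, 0)); exists h => // x.
by rewrite hp coeffD coeffB /= opprD addrA addrAC.
Qed.

Lemma lambda0_le6 (D : divisor (base S)) k : lambda0 3 D k -> (k <= 6)%N.
Proof. by move=> [x [_ _ kmin]]; exact: kmin (has_curve_6 x). Qed.

Lemma lambda0_curve_exists : exists k, lambda0_curve 3 S k.
Proof.
pose P k := `[< exists D : divisor (base S), deg D = 0 /\ lambda0 3 D k >].
have exP : exists k, P k.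
  have [k hk] := lambda0_exists (deg0 _); exists k; apply/asboolP; exists 0.
  by rewrite deg0.
have ubP k : P k -> (k <= 6)%N by move=> /asboolP [D [_ /lambda0_le6]].
case: (ex_maxnP exP ubP) => k /asboolP Pk kmax; exists k; split=> //.
  exact: lambda0_exists.
by move=> D l D0 Dl; apply: kmax; apply/asboolP; exists D.
Qed.

Lemma lambda0_curve_le6 k : lambda0_curve 3 S k -> (k <= 6)%N.
Proof. by move=> [_ [D [_ h]] _]; apply: lambda0_le6 h. Qed.

End UpperBound.

(** * The elliptic curve *)

Section EllipticCurve.
Variables (K : closedFieldType) (C : curve K).
Hypothesis charK : [pchar K] =i pred0.
Implicit Types (x y z : C) (A B D P : {poly K}) (a b c : K).
Local Notation ev P x := (map_poly (const C) P).[x].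

Lemma natK_neq0 n : (n.+1%:R : K) != 0.
Proof. by rewrite ((pcharf0P K).1 charK). Qed.

(** An induction principle instead of fractions of bivariate polynomials: it transfers to translated
    coordinates as soon as the old ones are rational in the new. *)
Definition generates x y : Prop := forall T : C -> Prop,
  (forall c, T (const C c)) -> T x -> T y ->
  (forall u v, T u -> T v -> T (u - v)) -> (forall u v, T u -> T v -> T (u * v)) ->
  (forall u, T u -> T u^-1) -> forall z, T z.

Definition coordinates x y : Prop := y ^+ 2 = x ^+ 3 - x + 1 /\ generates x y.

Lemma curve_coordinates : is_curve_y2_x3_x_1 C -> exists x y, coordinates x y.
Proof.
move=> [x [y [xy gen]]]; exists x, y; split=> // T Tc Tx Ty TB TM TV z.
have T0 : T 0 by rewrite -(rmorph0 (const C)).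
have TD u v : T u -> T v -> T (u + v).
  by move=> Tu Tv; rewrite -[v]opprK; apply: (TB _ _ Tu); rewrite -sub0r; apply: TB.
have Thorner (p : {poly C}) t : (forall i, T p`_i) -> T t -> T p.[t].
  elim/poly_ind: p => [|p c IH] Tp Tt; first by rewrite horner0.
  rewrite hornerMXaddC; apply: TD.
    by apply: TM => //; apply: IH => // i; have := Tp i.+1; rewrite coefD coefMX coefC addr0.
  by have := Tp 0; rewrite coefD coefMX coefC add0r.
have Tev (P : {poly {poly K}}) : T (eval2 P x y).
  rewrite /eval2; elim/poly_ind: P => [|P c IH]; first by rewrite rmorph0 !horner0.
  rewrite rmorphD rmorphM /= map_polyX map_polyC /= hornerMXaddC hornerD hornerM hornerC.
  by apply: TD; [apply: TM | apply: Thorner => // i; rewrite coef_map /=; apply: Tc].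
have [P [Q [_ ->]]] := gen z.
exact: TM (Tev P) (TV _ (Tev Q)).
Qed.


Definition weierstrass : {poly K} := 'X^3 - 'X + 1.

Lemma size_weierstrass : size weierstrass = 4%N.
Proof.
rewrite /weierstrass -addrA size_polyDl size_polyXn //.
by apply: leq_ltn_trans (size_polyD _ _) _; rewrite size_polyN size_polyX size_poly1.
Qed.

Lemma weierstrass_neq0 : weierstrass != 0.
Proof. by rewrite -size_poly_eq0 size_weierstrass. Qed.

Lemma horner_weierstrass x : ev weierstrass x = x ^+ 3 - x + 1.
Proof. by rewrite /weierstrass rmorphD rmorphB /= map_polyXn map_polyX rmorph1 !hornerE. Qed.

Lemma evM P Q x : ev (P * Q) x = ev P x * ev Q x.
Proof. by rewrite rmorphM hornerM. Qed.

Lemma evD P Q x : ev (P + Q) x = ev P x + ev Q x.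
Proof. by rewrite rmorphD hornerD. Qed.

Lemma evB P Q x : ev (P - Q) x = ev P x - ev Q x.
Proof. by rewrite rmorphB /= hornerD hornerN. Qed.

Lemma evN P x : ev (- P) x = - ev P x.
Proof. by rewrite rmorphN hornerN. Qed.

Lemma evXn P n x : ev (P ^+ n) x = ev P x ^+ n.
Proof. by rewrite rmorphXn horner_exp. Qed.

Lemma evXsubC a x : ev ('X - a%:P) x = x - const C a.
Proof. by rewrite map_polyXsubC hornerXsubC. Qed.

Lemma evC a x : ev a%:P x = const C a.
Proof. by rewrite map_polyC hornerC. Qed.

Lemma evX x : ev 'X x = x.
Proof. by rewrite map_polyX hornerX. Qed.

Lemma ev1 x : ev 1 x = 1.
Proof. by rewrite rmorph1 hornerC. Qed.

Lemma ev0 x : ev 0 x = 0.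
Proof. by rewrite rmorph0 hornerC. Qed.

Lemma root_factor P x : P != 0 -> ev P x = 0 -> exists c, x = const C c.
Proof.
move=> P0; have [r ->] := closed_field_poly_normal P.
rewrite -mul_polyC evM evC rmorph_prod horner_prod => /eqP.
rewrite mulf_eq0 fmorph_eq0 lead_coef_eq0 (negbTE P0) prodf_seq_eq0 => /hasP [c _] /=.
by rewrite evXsubC subr_eq0 => /eqP ->; exists c.
Qed.

Lemma closed_sqrt a : exists b, b ^+ 2 = a.
Proof.
have /closed_rootP [b] : size ('X^2 - a%:P) != 1.
  by rewrite size_polyDl size_polyXn // size_polyN; apply: leq_ltn_trans (size_polyC_leq1 _) _.
by rewrite rootE !hornerE subr_eq0 => /eqP; exists b.
Qed.

(* The norm of A(x) + B(x) y from K(x, y) to K(x). *)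
Definition norm A B : {poly K} := A ^+ 2 - B ^+ 2 * weierstrass.

Lemma size_sqr_poly A : size (A ^+ 2) = (2 * size A).-1.
Proof.
have [->|A0] := eqVneq A 0; first by rewrite expr0n size_poly0.
by rewrite expr2 size_mul // mul2n addnn.
Qed.

Lemma size_mul_sqr A B : A != 0 -> B != 0 -> size (A * B ^+ 2) = (size A + (2 * size B).-1).-1.
Proof. by move=> A0 B0; rewrite size_mul ?expf_neq0 // size_sqr_poly. Qed.

(** No cancellation is possible: [A ^+ 2] has even degree and [B ^+ 2 * weierstrass] odd degree. *)
Lemma size_norm A B :
  size (norm A B) = maxn (2 * size A).-1 (if (B == 0)%R then 0 else 2 * size B + 2)%N.
Proof.
have sB : size (B ^+ 2 * weierstrass) = (if (B == 0)%R then 0 else 2 * size B + 2)%N.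
  have [->|B0] := eqVneq B 0; first by rewrite expr0n mul0r size_poly0.
  rewrite size_mul ?expf_neq0 ?weierstrass_neq0 // size_weierstrass size_sqr_poly.
  by move: B0; rewrite -size_poly_gt0; case: (size B) => //= k _; lia.
rewrite /norm; case: (ltngtP (size (A ^+ 2)) (size (B ^+ 2 * weierstrass))).
- by move=> lt; rewrite addrC size_polyDl ?size_polyN //; move: lt; rewrite sB size_sqr_poly; lia.
- by move=> lt; rewrite size_polyDl ?size_polyN //; move: lt; rewrite sB size_sqr_poly; lia.
- rewrite sB size_sqr_poly => eq.
  have [B0 A0] : B = 0 /\ A = 0.
    move: eq; have [->|B0] := eqVneq B 0; last first.
      by move: B0; rewrite -size_poly_gt0; lia.
    by move=> eq; split=> //; apply/eqP; rewrite -size_poly_eq0; lia.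
  by rewrite B0 A0 expr0n mul0r subr0 size_poly0 eqxx.
Qed.

Lemma norm_eq0 A B : (norm A B == 0) = (A == 0) && (B == 0).
Proof.
rewrite -size_poly_eq0 size_norm -[A == 0]size_poly_eq0.
by case: (B == 0); rewrite ?andbT ?andbF; lia.
Qed.

Lemma normM A B A' B' :
  norm (A * A' + B * B' * weierstrass) (A * B' + A' * B) = norm A B * norm A' B'.
Proof. rewrite /norm; ring. Qed.


(** * The place at infinity *)

Section PlaceAtInfinity.
Variables x y : C.
Hypothesis xy : coordinates x y.
Local Notation comb A B := (ev A x + ev B x * y).

Lemma y_sqr : y ^+ 2 = ev weierstrass x.
Proof. by rewrite horner_weierstrass xy.1. Qed.

(** That is, [x] is transcendental: otherwise [x], then [y], then every function would be constant,
    as [K] is algebraically closed. *)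
Lemma ev_neq0 P : P != 0 -> ev P x != 0.
Proof.
move=> P0; apply/eqP => Px0.
have [a xa] := root_factor P0 Px0.
have [b yb] : exists b, y = const C b.
  have [e he] := closed_sqrt (a ^+ 3 - a + 1).
  have : (y - const C e) * (y + const C e) = 0.
    by rewrite -subr_sqr xy.1 xa -[const C e ^+ 2]rmorphXn he rmorphD rmorphB rmorphXn rmorph1 subrr.
  move/eqP; rewrite mulf_eq0 subr_eq0 addr_eq0 => /orP[]/eqP->; first by exists e.
  by exists (- e); rewrite rmorphN.
have all_const z : exists c, z = const C c.
  apply: (xy.2 (fun z => exists c, z = const C c)).
  - by move=> c; exists c.
  - by exists a.
  - by exists b.
  - by move=> _ _ [c ->] [d ->]; exists (c - d); rewrite rmorphB.
  - by move=> _ _ [c ->] [d ->]; exists (c * d); rewrite rmorphM.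
  - by move=> _ [c ->]; exists c^-1; rewrite fmorphV.
have [t [tr _]] := curveP C; have [c tc] := all_const t.
by have := tr _ (negbT (polyXsubC_eq0 c)); rewrite evXsubC tc subrr eqxx.
Qed.

Lemma ev_eq0 P : (ev P x == 0) = (P == 0).
Proof. by have [->|/ev_neq0/negbTE] := eqVneq P 0; rewrite ?ev0 ?eqxx. Qed.

Lemma combM A B A' B' :
  comb A B * comb A' B' = comb (A * A' + B * B' * weierstrass) (A * B' + A' * B).
Proof. rewrite !evD !evM -y_sqr; ring. Qed.

Lemma comb_conj A B : comb A B * comb A (- B) = ev (norm A B) x.
Proof. rewrite combM /norm !(evD, evN, evM, evXn); ring. Qed.

Lemma comb_eq0 A B : (comb A B == 0) = (A == 0) && (B == 0).
Proof.
apply/eqP/andP => [AB0|[/eqP-> /eqP->]]; last by rewrite !ev0 mul0r addr0.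
by apply/andP; rewrite -norm_eq0 -ev_eq0 -comb_conj AB0 mul0r.
Qed.

Lemma comb_rep z : exists ABD : {poly K} * {poly K} * {poly K},
  ABD.2 != 0 /\ z = comb ABD.1.1 ABD.1.2 / ev ABD.2 x.
Proof.
apply: (xy.2 (fun z => exists ABD : {poly K} * {poly K} * {poly K},
  ABD.2 != 0 /\ z = comb ABD.1.1 ABD.1.2 / ev ABD.2 x)).
- by move=> c; exists (c%:P, 0, 1); rewrite oner_neq0 /= evC ev0 ev1 mul0r addr0 divr1.
- by exists ('X : {poly K}, 0, 1); rewrite oner_neq0 /= evX ev0 ev1 mul0r addr0 divr1.
- by exists (0, 1, 1); rewrite oner_neq0 /= ev0 ev1 mul1r add0r divr1.
- move=> _ _ [[[A B] D] /= [D0 ->]] [[[A' B'] D'] /= [D'0 ->]].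
  exists (A * D' - A' * D, B * D' - B' * D, D * D') => /=; split; first by rewrite mulf_neq0.
  rewrite !evB !evM; field; by rewrite !ev_neq0.
- move=> _ _ [[[A B] D] /= [D0 ->]] [[[A' B'] D'] /= [D'0 ->]].
  exists (A * A' + B * B' * weierstrass, A * B' + A' * B, D * D') => /=; split; first by rewrite mulf_neq0.
  rewrite -combM evM; field; by rewrite !ev_neq0.
- move=> _ [[[A B] D] /= [D0 ->]].
  have [AB0|AB0] := eqVneq (comb A B) 0.
    by exists (0, 0, 1); rewrite oner_neq0 /= AB0 !ev0 !mul0r invr0 addr0 mul0r.
  have N0 : norm A B != 0 by rewrite norm_eq0 -comb_eq0.
  exists (D * A, - (D * B), norm A B) => /=; split=> //.
  have AB0' : comb A (- B) != 0.
    by apply: contraNneq N0 => e; rewrite -ev_eq0 -comb_conj e mulr0.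
  rewrite -comb_conj !(evN, evM); move: AB0 AB0'; rewrite evN => AB0 AB0'.
  field; by rewrite AB0 AB0' ev_neq0.
Qed.

(* The place at infinity is the only one above 1 / x = 0, so its valuation at z is
   the one of the norm of z at 1 / x = 0. *)
Definition infinity_val z : int :=
  let ABD := sval (cid (comb_rep z)) in
  if z == 0 then 0
  else (2 * (size ABD.2).-1)%N%:Z - ((size (norm ABD.1.1 ABD.1.2)).-1)%:Z.

(** Independence of the chosen representation: for two of them the norms satisfy [N D'^2 = N' D^2],
    and degrees are compared. *)
Lemma infinity_valE A B D : D != 0 -> comb A B != 0 ->
  infinity_val (comb A B / ev D x) = (2 * (size D).-1)%N%:Z - ((size (norm A B)).-1)%:Z.
Proof.
move=> D0 AB0; rewrite /infinity_val.
rewrite mulf_eq0 invr_eq0 (negbTE AB0) (negbTE (ev_neq0 D0)) /=.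
case: cid => [[[A' B'] D'] /= [D'0 e]].
have e0 : comb (A * D' - A' * D) (B * D' - B' * D) = 0.
  have : comb A B * ev D' x = comb A' B' * ev D x.
    apply: (mulIf (invr_neq0 (ev_neq0 D0))); apply: (mulIf (invr_neq0 (ev_neq0 D'0))).
    have -> : comb A B * ev D' x / ev D x / ev D' x = comb A B / ev D x.
      by field; rewrite !ev_neq0.
    by rewrite e; field; rewrite !ev_neq0.
  by move/eqP; rewrite -subr_eq0 !evB !evM => /eqP <-; ring.
move/eqP: e0; rewrite comb_eq0 !subr_eq0 => /andP[/eqP eA /eqP eB].
have nAB : norm A B != 0 by rewrite norm_eq0 -comb_eq0.
have eN : norm A B * D' ^+ 2 = norm A' B' * D ^+ 2.
  by rewrite /norm !mulrBl -!exprMn eA mulrAC -exprMn eB; ring.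
have nAB' : norm A' B' != 0.
  by apply: contraNneq nAB => e1; move: eN; rewrite e1 mul0r => /eqP; rewrite mulf_eq0 expf_eq0 (negbTE D'0) orbF.
have : size (norm A B * D' ^+ 2) = size (norm A' B' * D ^+ 2) by rewrite eN.
rewrite !size_mul_sqr //.
move: D0 D'0 nAB nAB'; rewrite -!size_poly_gt0.
by move: (size D) (size D') (size (norm A B)) (size (norm A' B')) => d d' n n'; lia.
Qed.


Lemma infinity_val0 : infinity_val 0 = 0.
Proof. by rewrite /infinity_val eqxx. Qed.

Lemma comb_rep_neq0 z : z != 0 -> exists A B D, [/\ D != 0, comb A B != 0 & z = comb A B / ev D x].
Proof.
have [[[A B] D] /= [D0 ->]] := comb_rep z; rewrite mulf_eq0 negb_or => /andP[AB0 _].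
by exists A, B, D.
Qed.

Lemma infinity_valM z z' : z != 0 -> z' != 0 ->
  infinity_val (z * z') = infinity_val z + infinity_val z'.
Proof.
move=> /comb_rep_neq0 [A [B [D [D0 AB0 ->]]]] /comb_rep_neq0 [A' [B' [D' [D'0 AB'0 ->]]]].
have -> : comb A B / ev D x * (comb A' B' / ev D' x) =
    comb (A * A' + B * B' * weierstrass) (A * B' + A' * B) / ev (D * D') x.
  by rewrite -combM evM; field; rewrite !ev_neq0.
rewrite !infinity_valE ?mulf_neq0 -?combM ?mulf_neq0 // normM.
have nAB : norm A B != 0 by rewrite norm_eq0 -comb_eq0.
have nAB' : norm A' B' != 0 by rewrite norm_eq0 -comb_eq0.
rewrite !size_mul //.
move: D0 D'0 nAB nAB'; rewrite -!size_poly_gt0.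
by move: (size D) (size D') (size (norm A B)) (size (norm A' B')) => d d' n n'; lia.
Qed.

Lemma size_normD A B A' B' :
  (size (norm (A + A') (B + B')) <= maxn (size (norm A B)) (size (norm A' B')))%N.
Proof.
rewrite !size_norm.
have := size_polyD A A'; have := size_polyD B B'.
have [->|B0] := eqVneq B 0; have [->|B'0] := eqVneq B' 0; rewrite ?add0r ?addr0 ?eqxx ?(negbTE B0) ?(negbTE B'0) ?size_poly0.
- by lia.
- by lia.
- by lia.
- by case: eqP; lia.
Qed.

Lemma infinity_valD z z' : z != 0 -> z' != 0 -> z + z' != 0 ->
  Num.min (infinity_val z) (infinity_val z') <= infinity_val (z + z').
Proof.
move=> /comb_rep_neq0 [A [B [D [D0 AB0 ->]]]] /comb_rep_neq0 [A' [B' [D' [D'0 AB'0 ->]]]].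
have mulD (P Q E F : {poly K}) : E != 0 -> F != 0 -> comb P Q / ev E x = comb (P * F) (Q * F) / ev (E * F) x.
  by move=> E0 F0; rewrite !evM; field; rewrite !ev_neq0.
have mulC (P Q E : {poly K}) : E != 0 -> comb P Q != 0 -> comb (P * E) (Q * E) != 0.
  by move=> E0; rewrite !comb_eq0 !mulf_eq0 (negbTE E0) !orbF.
rewrite (mulD A B D D') // (mulD A' B' D' D) // (mulrC D').
have := mulC _ _ _ D'0 AB0; have := mulC _ _ _ D0 AB'0.
have := mulf_neq0 D0 D'0; move: (D * D') (A * D') (B * D') (A' * D) (B' * D).
move=> {D D' D0 D'0 AB0 AB'0 A B A' B'} D A B A' B' D0 AB'0 AB0.
rewrite -mulrDl.
have -> : comb A B + comb A' B' = comb (A + A') (B + B') by rewrite !evD; ring.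
rewrite mulf_eq0 negb_or => /andP[ABs _].
rewrite !infinity_valE //.
have := size_normD A B A' B'; rewrite ge_min.
by move: (size _) (size _) (size _) => a b c le; apply/orP; lia.
Qed.

Lemma infinity_valK c : c != 0 -> infinity_val (const C c) = 0.
Proof.
move=> c0; have -> : const C c = comb c%:P 0 / ev 1 x by rewrite evC ev0 ev1 mul0r addr0 divr1.
rewrite infinity_valE ?oner_neq0 ?comb_eq0 ?polyC_eq0 ?negb_and ?c0 //.
by rewrite size_norm eqxx size_poly1 size_polyC c0.
Qed.

Lemma x_rep : x = comb 'X 0 / ev 1 x.
Proof. by rewrite evX ev0 ev1 mul0r addr0 divr1. Qed.

Lemma y_rep : y = comb 0 1 / ev 1 x.
Proof. by rewrite ev0 ev1 mul1r add0r divr1. Qed.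

Lemma infinity_val_x : infinity_val x = - 2.
Proof.
rewrite {1}x_rep infinity_valE ?oner_neq0 ?comb_eq0 ?negb_and ?polyX_eq0 //.
by rewrite size_norm eqxx size_poly1 size_polyX.
Qed.

Lemma infinity_val_y : infinity_val y = - 3.
Proof.
rewrite {1}y_rep infinity_valE ?oner_neq0 ?comb_eq0 ?negb_and ?oner_neq0 ?orbT //.
by rewrite size_norm oner_eq0 size_poly1 size_poly0.
Qed.

Lemma x_neq0 : x != 0.
Proof. by rewrite -(evX x) ev_eq0 polyX_eq0. Qed.

Lemma y_neq0 : y != 0.
Proof. by have := comb_eq0 0 1; rewrite ev0 ev1 mul1r add0r oner_eq0 andbF => ->. Qed.

Lemma infinity_val_uniformizer : exists2 f : C, f != 0 & infinity_val f = 1.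
Proof.
have V f : f != 0 -> infinity_val f^-1 = - infinity_val f.
  move=> f0; apply/eqP; rewrite -addr_eq0 -infinity_valM ?invr_eq0 // mulVf //.
  by rewrite -(rmorph1 (const C)) infinity_valK ?oner_neq0.
exists (x / y); first by rewrite mulf_neq0 ?invr_eq0 ?x_neq0 ?y_neq0.
by rewrite infinity_valM ?invr_eq0 ?x_neq0 ?y_neq0 // V ?y_neq0 // infinity_val_x infinity_val_y.
Qed.

Definition infinity : place C :=
  Place infinity_val0 infinity_valM infinity_valD infinity_valK infinity_val_uniformizer.

Lemma place_ext (p q : place C) : p =1 q -> p = q.
Proof.
case: p q => [v a b c d e] [v' a' b' c' d' e'] /= /funext vv'; subst v'.
by f_equal; apply: Prop_irrelevance.
Qed.

Lemma val_ev (p : place C) P : p x < 0 -> P != 0 -> p (ev P x) = p x *+ (size P).-1.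
Proof.
move=> px; elim/poly_ind: P => [|P c IH]; first by rewrite eqxx.
have [->|P0] := eqVneq P 0.
  rewrite mul0r add0r polyC_eq0 => c0; rewrite evC val_const // size_polyC c0 //.
move=> _; rewrite size_MXaddC (negbTE P0) /= evD evM evX evC.
have vP : p (ev P x * x) = p x *+ size P.
  rewrite valM ?ev_neq0 ?x_neq0 // IH // -mulrSr prednK // size_poly_gt0 //.
have [] := @val_addr _ _ p (ev P x * x) (const C c).
- by rewrite mulf_neq0 ?ev_neq0 ?x_neq0.
- apply: vgeW (vge_const p c); rewrite vP.
  have : (0 < size P)%N by rewrite size_poly_gt0.
  case: (size P) => // n _; rewrite mulrSr; have : p x *+ n <= 0 by rewrite mulrn_wle0 // ltW.
  by lia.
- by move=> _ ->.
Qed.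

(** The equation forces v(x) = -2k and v(y) = -3k. By parity no cancellation occurs in A(x) + B(x)
    y, so v is k times [infinity_val], and k = 1 because v is normalized. *)
Lemma infinity_unique (p : place C) : p x < 0 -> p = infinity.
Proof.
move=> px; apply: place_ext => z /=.
have e23 : p y *+ 2 = p x *+ 3.
  by rewrite -valX y_sqr val_ev ?weierstrass_neq0 // size_weierstrass.
pose k := p x - p y.
have ek : p x = - k *+ 2 /\ p y = - k *+ 3 by rewrite /k; lia.
have k0 : 0 < k by lia.
have vcomb A B : comb A B != 0 -> p (comb A B) = - k *+ (size (norm A B)).-1.
  rewrite comb_eq0 negb_and size_norm; have [->|B0] := eqVneq B 0.
    rewrite /= orbF => A0; rewrite ev0 mul0r addr0 val_ev // ek.1 -mulrnA maxn0.
    by congr (_ *+ _); move: (size A) => a; lia.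
  have vB : p (ev B x * y) = - k *+ (2 * size B).+1.
    rewrite valM ?ev_neq0 ?y_neq0 // val_ev // ek.1 ek.2 -mulrnA -mulrnDr.
    by congr (_ *+ _); move: B0; rewrite -size_poly_gt0; move: (size B) => b; lia.
  have By0 : ev B x * y != 0 by rewrite mulf_neq0 ?ev_neq0 ?y_neq0.
  have [->|A0 _] := eqVneq A 0.
    by move=> _; rewrite ev0 add0r vB size_poly0; congr (_ *+ _); move: (size B) => b; lia.
  have vA : p (ev A x) = - k *+ (2 * (size A).-1).
    by rewrite val_ev // ek.1 -mulrnA.
  have lt n m : (n < m)%N -> - k *+ m + 1 <= - k *+ n.
    by move=> nm; rewrite !mulrn_int; nia.
  move: A0; rewrite -size_poly_gt0 => A0.
  have A0' : ev A x != 0 by rewrite ev_neq0 // -size_poly_gt0.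
  have [le|gt] := leqP (2 * (size A).-1) (2 * size B).+1.
    have [|_] := @val_addr _ _ p _ (ev A x) By0.
      by rewrite /vge vB vA; apply/orP; right; apply: lt; move: (size A) (size B) A0 le => a b; lia.
    by rewrite addrC vB => ->; congr (_ *+ _); move: (size A) (size B) A0 le => a b; lia.
  have [|_ ->] := @val_addr _ _ p _ (ev B x * y) A0'.
    by rewrite /vge vB vA; apply/orP; right; apply: lt; move: (size A) (size B) A0 gt => a b; lia.
  by rewrite vA; congr (_ *+ _); move: (size A) (size B) A0 gt => a b; lia.
have val_k f : f != 0 -> p f = k * infinity_val f.
  move=> /comb_rep_neq0 [A [B [D [D0 AB0 ->]]]].
  rewrite infinity_valE // valM ?invr_eq0 ?ev_neq0 // valV vcomb // val_ev // ek.1.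
  by rewrite !mulrn_int; move: (size D).-1 (size _).-1 => d n; nia.
have k1 : k = 1.
  have [u u0 pu] := val_uniformizer p; move: (val_k _ u0); rewrite pu.
  move: (infinity_val u) (k) k0 => m k' k'0 e.
  have m0 : 0 < m by rewrite -(pmulr_rgt0 _ k'0) -e.
  by nia.
have [->|z0] := eqVneq z 0; first by rewrite val0 infinity_val0.
by rewrite val_k // k1 mul1r.
Qed.

End PlaceAtInfinity.
End EllipticCurve.

(** * Translations and the affine places *)

Section Translation.
Variables (K : closedFieldType) (C : curve K).
Hypothesis charK : [pchar K] =i pred0.
Implicit Types (x y z : C) (A B D P : {poly K}) (a b c : K) (v p : place C).
Local Notation ev P x := (map_poly (const C) P).[x].

(** The discriminant of x^3 - x + 1 is -23; the two identities are Euclid's algorithm for the cubic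
    and its derivative, ending in 23. *)
Lemma smooth a : a ^+ 3 - a + 1 = 0 -> 3 * a ^+ 2 - 1 != 0.
Proof.
move=> f0; apply/eqP => f'0; have /eqP := natK_neq0 charK 22; apply.
have e : 3 * (a ^+ 3 - a + 1) - a * (3 * a ^+ 2 - 1) = 3 - 2 * a by ring.
have {}e : 3 - 2 * a = 0 by rewrite -e f0 f'0; ring.
have -> : 23%:R = 4 * (3 * a ^+ 2 - 1) + 3 * (3 - 2 * a) * (3 + 2 * a) by ring.
by rewrite e f'0; ring.
Qed.

Lemma const_point a b : b ^+ 2 = a ^+ 3 - a + 1 ->
  const C b ^+ 2 = const C a ^+ 3 - const C a + 1.
Proof. by move=> h; rewrite -rmorphXn h rmorphD rmorphB rmorphXn rmorph1. Qed.

(* x and y at the point P - (a, b), by the chord through P and (a, -b). *)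
Definition slope x y a b : C := (y + const C b) / (x - const C a).
Definition translate_x x y a b : C := slope x y a b ^+ 2 - x - const C a.
Definition translate_y x y a b : C := slope x y a b * (x - translate_x x y a b) - y.

Section Point.
Variables (x y : C) (a b : K).
Hypotheses (xy : coordinates x y) (hab : b ^+ 2 = a ^+ 3 - a + 1).
Let l := slope x y a b.
Let x' := translate_x x y a b.
Let y' := translate_y x y a b.

Lemma xa_neq0 : x - const C a != 0.
Proof. by rewrite -evXsubC (ev_neq0 xy) // polyXsubC_eq0. Qed.

Lemma slopeE : y = l * (x - const C a) - const C b.
Proof. by rewrite /l /slope divfK ?xa_neq0 // addrK. Qed.

Lemma translate_yE : y' = const C b - l * (x' - const C a).
Proof. by rewrite /y' /translate_y -/l -/x' {1}slopeE; ring. Qed.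

Lemma x_translate : x = l ^+ 2 - x' - const C a.
Proof. by rewrite /x' /translate_x -/l; ring. Qed.

(** If x' were the constant a, the chord formula would become a relation A(x) + 2b y = 0; so b = 0
    and a would be a double root of the cubic. *)
Lemma translate_neq : x' - const C a != 0.
Proof.
apply/eqP => xa.
have e : (y + const C b) ^+ 2 = (x + 2 * const C a) * (x - const C a) ^+ 2.
  rewrite [y]slopeE subrK exprMn; congr (_ * _).
  have : l ^+ 2 = x' - const C a + x + 2 * const C a by rewrite /x' /translate_x -/l; ring.
  by rewrite xa add0r.
have : ev (weierstrass K + (b ^+ 2)%:P - ('X + (2 * a)%:P) * ('X - a%:P) ^+ 2) x + ev (2 * b)%:P x * y = 0.
  rewrite evB evD -(y_sqr xy) !(evD, evN, evM, evXn, evX, evC) !rmorphM rmorph_nat.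
  have -> : y ^+ 2 + const C b * const C b = (y + const C b) ^+ 2 - 2 * const C b * y by ring.
  by rewrite e; ring.
move/eqP; rewrite (comb_eq0 xy) polyC_eq0 mulf_eq0 (negbTE (natK_neq0 charK 1)) /= => /andP[/eqP eP /eqP b0].
move: hab eP; rewrite b0 expr0n polyC0 addr0 => /esym /smooth /eqP f' eP; apply: f'.
(* The difference of the values at a + 1 and a - 1 is twice the derivative of the cubic at a. *)
have := congr1 (fun P : {poly K} => P.[a + 1]) eP.
have := congr1 (fun P : {poly K} => P.[a - 1]) eP.
rewrite /weierstrass /= !(hornerD, hornerN, hornerM, horner_exp, hornerX, hornerC) => e1 e2.
have two := natK_neq0 charK 1.
apply: (mulfI two); rewrite mulr0.
have -> : 2 * (3 * a ^+ 2 - 1) = (a + 1) ^+ 3 - (a + 1) + 1 - (a + 1 + 2 * a) * (a + 1 - a) ^+ 2 -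
  ((a - 1) ^+ 3 - (a - 1) + 1 - (a - 1 + 2 * a) * (a - 1 - a) ^+ 2) by ring.
by rewrite e1 e2 subrr.
Qed.

Lemma translate_coordinates : coordinates x' y'.
Proof.
have hab' := const_point hab; set A := const C a in hab'; set B := const C b in hab'.
split.
  (* The equation of the curve restricted to the chord, divided by x - a. *)
  have R : l ^+ 2 * (x - A) - 2 * l * B - (x ^+ 2 + x * A + A ^+ 2 - 1) = 0.
    apply: (mulfI xa_neq0); rewrite mulr0.
    have : (l * (x - A) - B) ^+ 2 = x ^+ 3 - x + 1 by rewrite -slopeE xy.1.
    move/eqP; rewrite -subr_eq0 => /eqP h; rewrite -/A -[RHS]h.
    have -> : (l * (x - A) - B) ^+ 2 = l ^+ 2 * (x - A) ^+ 2 - 2 * l * B * (x - A) + B ^+ 2 by ring.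
    rewrite hab'; ring.
  apply/eqP; rewrite -subr_eq0; apply/eqP.
  have -> : y' ^+ 2 - (x' ^+ 3 - x' + 1) = (B ^+ 2 - (A ^+ 3 - A + 1)) + (x' - A) *
     ((l ^+ 2 * (x - A) - 2 * l * B - (x ^+ 2 + x * A + A ^+ 2 - 1)) +
      (x - x') * (x + x' + A - l ^+ 2)).
    by rewrite translate_yE -/A -/B; ring.
  by rewrite R hab' {2}x_translate -/A; ring.
move=> T Tc Tx' Ty' TB TM TV.
have T0 : T 0 by rewrite -(rmorph0 (const C)).
have TN u : T u -> T (- u) by rewrite -sub0r; apply: TB.
have Tl : T l.
  have -> : l = - ((y' - const C b) / (x' - const C a)).
    by rewrite translate_yE; field; exact: translate_neq.
  by apply: TN; apply: (TM); [apply: (TB) | apply: TV; apply: (TB)].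
have Tx : T x by rewrite x_translate expr2; apply: (TB) => //; apply: (TB) => //; apply: TM.
by apply: xy.2 => //; rewrite slopeE; apply: (TB) => //; apply: (TM) => //; apply: (TB).
Qed.

End Point.

Section Places.
Variables x y : C.
Hypothesis xy : coordinates x y.

Lemma infinity_x : infinity xy x = - 2.
Proof. exact: infinity_val_x. Qed.

Lemma infinity_y : infinity xy y = - 3.
Proof. exact: infinity_val_y. Qed.

Lemma ge0_off_infinity v : v != infinity xy -> vge v 0 x /\ vge v 0 y.
Proof.
move=> vi; have x0 : vge v 0 x.
  by apply: contraR vi; rewrite vgeNE => /(infinity_unique xy) ->.
split=> //; apply: contraLR x0; rewrite !vgeNE => y0.
have : v (y ^+ 2) < 0 by rewrite valX; lia.
rewrite xy.1; apply: contraTT; rewrite -!vgeNE !negbK => x0.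
by apply: vgeD => //; apply: vgeB => //; apply: vgeX0.
Qed.

Lemma vge_ev v P : vge v 0 x -> vge v 0 (ev P x).
Proof.
move=> x0; elim/poly_ind: P => [|P c IH]; first by rewrite ev0.
by rewrite evD evM evX evC; apply: vgeD => //; apply: vgeMl.
Qed.

Lemma vge_evB v P a : vge v 0 x -> vge v 1 (x - const C a) -> vge v 1 (ev P x - const C P.[a]).
Proof.
move=> x0 xa; have /factor_theorem [Q e] : root (P - P.[a]%:P) a by rewrite rootE !hornerE subrr.
by rewrite -(evC _ x) -evB e evM evXsubC; apply: vgeMl => //; apply: vge_ev.
Qed.

Lemma point_of_place v : v != infinity xy -> exists a b,
  [/\ b ^+ 2 = a ^+ 3 - a + 1, vge v 1 (x - const C a) & vge v 1 (y - const C b)].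
Proof.
move=> /ge0_off_infinity [x0 y0].
have [a xa] := residue x0; have [b yb] := residue y0; exists a, b; split=> //.
apply/eqP; rewrite -subr_eq0; apply/eqP; apply: (@const_vge1 _ _ v).
have -> : const C (b ^+ 2 - (a ^+ 3 - a + 1)) =
   (ev (weierstrass K) x - const C (weierstrass K).[a]) - (y + const C b) * (y - const C b).
  rewrite -(y_sqr xy) /weierstrass !(hornerD, hornerN, hornerM, horner_exp, hornerX, hornerC).
  by ring.
apply: vgeB; first exact: vge_evB.
by apply: vgeMl => //; apply: vgeD.
Qed.

Section At.
Variables (a b : K).
Hypothesis hab : b ^+ 2 = a ^+ 3 - a + 1.

(* The point (a, b) is the point at infinity for the translated coordinates. *)
Definition place_at : place C := infinity (translate_coordinates xy hab).

Let l := slope x y a b.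
Let x' := translate_x x y a b.
Let y' := translate_y x y a b.

Lemma y_factor : (y - const C b) * (y + const C b) =
  (x - const C a) * (x ^+ 2 + const C a * x + const C a ^+ 2 - 1).
Proof. rewrite -subr_sqr xy.1 (const_point hab); ring. Qed.

Lemma place_at_x : vge place_at 1 (x - const C a).
Proof.
have vx' : place_at x' = -2 by apply: infinity_val_x.
have vy' : place_at y' = -3 by apply: infinity_val_y.
have [x'0 y'0] : x' != 0 /\ y' != 0 by split; apply: (@val_lt0 _ _ place_at); rewrite ?vx' ?vy'.
have [_ vx'a] : x' - const C a != 0 /\ place_at (x' - const C a) = -2.
  rewrite -vx'; apply: val_addr => //; rewrite vgeN vx'; exact: vgeW (vge_const _ _).
have x'a0 := translate_neq xy hab.
(* The terms x'^3 cancel in this product, which leaves a pole of order at most 3, while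
   [(x' - const C a) ^+ 2] has one of order 4. *)
have : vge place_at (- 3) ((x - const C a) * (x' - const C a) ^+ 2).
  have -> : (x - const C a) * (x' - const C a) ^+ 2 = const C (- (2 * b)) * y' +
     const C (3 * a ^+ 2 - 1) * x' + const C (1 + b ^+ 2 - 2 * a ^+ 3).
    have lE : (y' - const C b) ^+ 2 = l ^+ 2 * (x' - const C a) ^+ 2.
      by rewrite /y' (translate_yE a b xy) -/l -/x'; ring.
    have -> : (x - const C a) * (x' - const C a) ^+ 2 =
        l ^+ 2 * (x' - const C a) ^+ 2 - (x' + 2 * const C a) * (x' - const C a) ^+ 2.
      by rewrite [in LHS](x_translate x y a b) -/l -/x'; ring.
    rewrite -lE !rmorphE.
    have e : y' ^+ 2 = x' ^+ 3 - x' + 1 := (translate_coordinates xy hab).1.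
    have -> : (y' - const C b) ^+ 2 = y' ^+ 2 - 2 * const C b * y' + const C b ^+ 2 by ring.
    by rewrite e; ring.
  apply: vgeD; [apply: vgeD|exact: vgeW (vge_const _ _)]; apply: vgeZ.
    by rewrite vgeE // vy'.
  by rewrite vgeE // vx'.
have x'a2 : (x' - const C a) ^+ 2 != 0 by rewrite expf_neq0.
by move=> /(vge_divr x'a2 (erefl _)); rewrite valX vx'a; apply: vgeW.
Qed.

(** The slope has a pole at v, so its square dominates x'. The pole of x' identifies v with
    [place_at], and its order then tells which of x - a and y is a uniformizer. *)
Lemma val_translate v : vge v 1 (x - const C a) -> vge v 1 (y - const C b) ->
  [/\ v x' < 0, b != 0 -> v x' = v (x - const C a) *- 2 &
      b = 0 -> v x' = v y *- 2 /\ v (x - const C a) = v y *+ 2].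
Proof.
move=> xa yb; have xa0 := xa_neq0 a xy.
have x0 : vge v 0 x by rewrite -[x](subrK (const C a)); apply: vgeD => //; apply: vgeW xa.
have vxa : 0 < v (x - const C a) by move: xa; rewrite vgeE //; lia.
have vx' m : 0 < m -> l != 0 -> v l = - m -> v x' = m *- 2.
  move=> m0 l0 vl; have l20 : l ^+ 2 != 0 by rewrite expf_neq0.
  have [|_] := @val_addr _ _ v (l ^+ 2) (- x - const C a) l20.
    apply: vgeB; [rewrite vgeN; apply: vgeW x0|apply: vgeW (vge_const _ _)]; rewrite valX vl; lia.
  rewrite addrA -/(translate_x _ _ _ _) => ->; rewrite valX vl; lia.
have [b0|b0] := eqVneq b 0.
  have y0 : vge v 1 y by move: yb; rewrite b0 rmorph0 subr0.
  have yn0 := y_neq0 xy.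
  have vy : 0 < v y by move: y0; rewrite vgeE //; lia.
  have e : y * y = (x - const C a) * (x ^+ 2 + const C a * x + const C a ^+ 2 - 1).
    by rewrite -y_factor b0 rmorph0 subr0 addr0.
  have f0 : 3 * a ^+ 2 - 1 != 0 by apply: smooth; rewrite -hab b0 expr0n.
  have [] := @val_unit _ _ v (x ^+ 2 + const C a * x + const C a ^+ 2 - 1) _ f0.
    have -> : x ^+ 2 + const C a * x + const C a ^+ 2 - 1 - const C (3 * a ^+ 2 - 1) =
       (x + 2 * const C a) * (x - const C a) by ring.
    by apply: vgeMl => //; apply: vgeD => //; apply: vgeMl.
  move=> u0 vu.
  have vxy : v (x - const C a) = v y *+ 2.
    by have := congr1 v e; rewrite !valM // vu; lia.
  have l0 : l != 0 by rewrite /l /slope b0 rmorph0 addr0 mulf_neq0 ?invr_eq0.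
  have vl : v l = - v y.
    by rewrite /l /slope b0 rmorph0 addr0 valM ?invr_eq0 // valV vxy; lia.
  by rewrite (vx' _ vy l0 vl); split=> //; lia.
have [yb0 vyb] : y + const C b != 0 /\ v (y + const C b) = 0.
  apply: (@val_unit _ _ v _ (2 * b)); first by rewrite mulf_neq0 // (natK_neq0 charK 1).
  by have -> : y + const C b - const C (2 * b) = y - const C b by ring.
have l0 : l != 0 by rewrite mulf_neq0 ?invr_eq0.
have vl : v l = - v (x - const C a) by rewrite /l /slope valM ?invr_eq0 // valV vyb add0r.
by rewrite (vx' _ vxa l0 vl); split=> // [|e]; [lia | rewrite e eqxx in b0].
Qed.

Lemma place_at_unique v : vge v 1 (x - const C a) -> vge v 1 (y - const C b) -> v = place_at.
Proof. by move=> xa yb; have [? _ _] := val_translate xa yb; apply: infinity_unique. Qed.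

(** As x has residue a, y has residue b or -b. If it were -b with b nonzero, rewriting the slope
    with denominator y - b would make it regular, and x' too. *)
Lemma place_at_y : vge place_at 1 (y - const C b).
Proof.
have xa := place_at_x; have xa0 := xa_neq0 a xy.
have x0 : vge place_at 0 x by rewrite -[x](subrK (const C a)); apply: vgeD => //; apply: vgeW xa.
have v_inf : place_at != infinity xy.
  by apply/eqP => e; move: x0; rewrite e vgeE ?(x_neq0 xy) // infinity_x.
have [_ y0] := ge0_off_infinity v_inf.
have f0 : vge place_at 0 (x ^+ 2 + const C a * x + const C a ^+ 2 - 1).
  by apply: vgeB => //; apply: vgeD; [apply: vgeD; [apply: vgeX0 | apply: vgeZ] | apply: vgeX0].
have [a' [b' [h' xa' yb']]] := point_of_place v_inf.
have ea : a' = a.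
  apply/eqP; rewrite -subr_eq0; apply/eqP; apply: (@const_vge1 _ _ place_at).
  have -> : const C (a' - a) = (x - const C a) - (x - const C a') by rewrite rmorphB; ring.
  exact: vgeB.
move: h' => /eqP; rewrite ea -hab -subr_eq0 subr_sqr mulf_eq0 subr_eq0 addr_eq0.
case/orP=> /eqP eb; first by rewrite -eb.
have [b0|b0] := eqVneq b 0; first by move: yb'; rewrite eb b0 oppr0.
have yb : vge place_at 1 (y + const C b) by move: yb'; rewrite eb rmorphN opprK.
have vx' : place_at x' = -2 by apply: infinity_val_x.
have [yb0 vyb] : y - const C b != 0 /\ place_at (y - const C b) = 0.
  apply: (@val_unit _ _ place_at _ (- (2 * b))).
    by rewrite oppr_eq0 mulf_neq0 // (natK_neq0 charK 1).
  by have -> : y - const C b - const C (- (2 * b)) = y + const C b by ring.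
have l0 : vge place_at 0 l.
  have -> : l = (x ^+ 2 + const C a * x + const C a ^+ 2 - 1) / (y - const C b).
    apply: (mulIf xa0); rewrite /l /slope divfK //; apply: (mulIf yb0).
    by rewrite mulrC y_factor; field.
  by rewrite -[0]addr0; apply: vgeM => //; rewrite vgeE ?invr_eq0 // valV vyb.
have : vge place_at 0 x'.
  by apply: vgeB => //; apply: vgeB => //; apply: vgeX0.
by rewrite vgeE ?vx' //; apply: (@val_lt0 _ _ place_at); rewrite vx'.
Qed.

Lemma val_place_at v : vge v 1 (x - const C a) -> vge v 1 (y - const C b) ->
  (b != 0 -> v (x - const C a) = 1) /\ (b = 0 -> v y = 1 /\ v (x - const C a) = 2).
Proof.
move=> xa yb; have [_ hb hb0] := val_translate xa yb.
have vx' : v x' = -2 by rewrite (place_at_unique xa yb); apply: infinity_val_x.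
by split=> [/hb|/hb0 []]; rewrite vx'; lia.
Qed.

End At.
End Places.
End Translation.

(** * The genus of the elliptic curve *)

Section Genus.
Variables (K : closedFieldType) (C : curve K).
Hypothesis charK : [pchar K] =i pred0.
Implicit Types (z : C) (A B D P : {poly K}) (a b c : K) (v p : place C).
Local Notation ev P x := (map_poly (const C) P).[x].
Variables x y : C.
Hypothesis xy : coordinates x y.
Local Notation oo := (infinity xy).
Local Notation comb A B := (ev A x + ev B x * y).

Lemma ge0_place_at a b (hab : b ^+ 2 = a ^+ 3 - a + 1) :
  place_at charK xy hab != oo.
Proof.
have xa := place_at_x charK xy hab.
have x0 : vge (place_at charK xy hab) 0 x.
  exact: vge_residue xa.
by apply/eqP => e; move: x0; rewrite e vgeE ?(x_neq0 xy) // infinity_x.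
Qed.

(* At the two points over x = a, or at the branch point y = 0, where x - a
   vanishes twice, divisibility of A(x) + B(x) y by x - a gives A(a) = B(a) = 0. *)
Lemma comb_divisible a A B z :
  (forall v, v != oo -> vge v 0 z) -> z * (x - const C a) = comb A B ->
  A.[a] = 0 /\ B.[a] = 0.
Proof.
move=> z0 e; have [b hab] := closed_sqrt (a ^+ 3 - a + 1).
have at_pt b' (h : b' ^+ 2 = a ^+ 3 - a + 1) : A.[a] + B.[a] * b' = 0.
  pose v := place_at charK xy h.
  have voo : v != oo by apply: ge0_place_at.
  have [vx vy] := ge0_off_infinity voo.
  have xa := place_at_x charK xy h : vge v 1 _.
  have yb := place_at_y charK xy h : vge v 1 _.
  apply: (@const_vge1 _ _ v).
  have -> : const C (A.[a] + B.[a] * b') = comb A B - (ev A x - const C A.[a]) -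
    (ev B x - const C B.[a]) * y - const C B.[a] * (y - const C b') by ring.
  apply: vgeB; last by apply: vgeZ.
  apply: vgeB; last by rewrite mulrC; apply: vgeMl => //; apply: vge_evB.
  apply: vgeB; last exact: vge_evB.
  by rewrite -e; apply: vgeMl => //; apply: z0.
have [b0|b0] := eqVneq b 0; last first.
  have h' : (- b) ^+ 2 = a ^+ 3 - a + 1 by rewrite sqrrN.
  have e1 := at_pt _ hab; have e2 := at_pt _ h'; have two := natK_neq0 charK 1.
  have eA : A.[a] = 0.
    apply: (mulfI two); have -> : 2 * A.[a] = (A.[a] + B.[a] * b) + (A.[a] + B.[a] * - b) by ring.
    by rewrite e1 e2; ring.
  split=> //; apply: (mulIf b0); rewrite mul0r -[RHS]e1 eA; ring.
have eA : A.[a] = 0 by have := at_pt _ hab; rewrite b0 mulr0 addr0.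
split=> //; pose v := place_at charK xy hab.
have voo : v != oo by apply: ge0_place_at.
have [vx vy] := ge0_off_infinity voo.
have xa := place_at_x charK xy hab : vge v 1 _.
have yb := place_at_y charK xy hab : vge v 1 _.
have [_ /(_ b0) [v1 v2]] := val_place_at charK xy hab xa yb.
have xa2 : vge v 2 (x - const C a) by rewrite vgeE ?(xa_neq0 a xy) // v2.
have [Q eQ] : exists Q, A = Q * ('X - a%:P) by apply/factor_theorem/eqP.
have : vge v 2 (ev B x * y).
  have -> : ev B x * y = z * (x - const C a) - ev Q x * (x - const C a) by rewrite e eQ evM evXsubC; ring.
  by apply: vgeB; apply: vgeMl => //; [apply: z0 | apply: vge_ev].
move=> /(vge_divr (y_neq0 xy) v1) vB.
apply: (@const_vge1 _ _ v).
have -> : const C B.[a] = ev B x - (ev B x - const C B.[a]) by ring.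
by apply: vgeB => //; apply: vge_evB.
Qed.

(** The linear factors of the denominator cancel one by one by [comb_divisible]: K[x, y] is the full
    ring of the affine curve. *)
Lemma regular_off_infinity z : (forall v, v != oo -> vge v 0 z) ->
  exists A B, z = comb A B.
Proof.
move=> z0; have [[[A B] D] /= [D0 e]] := comb_rep xy z.
have {}e : z * ev D x = comb A B by rewrite e divfK ?(ev_neq0 xy).
move: {2}(size D) (leqnn (size D)) => n.
elim: n A B D D0 e => [|n IH] A B D D0 e.
  by rewrite leqNgt size_poly_gt0 D0.
move=> sD; have [/size_poly1P [d d0 eD]|/closed_rootP [a ra]] := boolP (size D == 1%N).
  exists (d^-1 *: A), (d^-1 *: B); have d0' : const C d != 0 by rewrite fmorph_eq0.
  apply: (mulIf d0'); move: e; rewrite eD evC => ->.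
  by rewrite -!mul_polyC !evM evC fmorphV; field.
have [D' eD] : exists D', D = D' * ('X - a%:P) by apply/factor_theorem.
have D'0 : D' != 0 by apply: contraNneq D0 => e0; rewrite eD e0 mul0r.
have [||eA eB] := @comb_divisible a A B (z * ev D' x).
- by move=> v voo; rewrite mulrC; apply: vgeMl; [apply: vge_ev; have [] := ge0_off_infinity voo | apply: z0].
- by rewrite -mulrA -evXsubC -evM -eD.
have [A' eA'] : exists Q, A = Q * ('X - a%:P) by apply/factor_theorem/eqP.
have [B' eB'] : exists Q, B = Q * ('X - a%:P) by apply/factor_theorem/eqP.
apply: (IH A' B' D' D'0); last by move: sD; rewrite eD size_Mmonic ?monicXsubC // size_XsubC addn2.
apply: (mulIf (xa_neq0 a xy)); rewrite -mulrA -!evXsubC -evM -eD e eA' eB' !evM; ring.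
Qed.

(** No function in K[x, y] has pole order one: a nonconstant A(x) has even order, and B(x) y
    contributes order at least three. *)
Lemma riemann_infinity z : riemann_space << oo >> z -> exists c, z = const C c.
Proof.
move=> zoo; have [|A [B e]] := @regular_off_infinity z.
  by move=> v voo; have := zoo v; rewrite coeff_pt eq_sym (negbTE voo).
have := zoo oo; rewrite coeff_pt eqxx /=; have [->|z0] := eqVneq z 0.
  by exists 0; rewrite rmorph0.
have AB0 : comb A B != 0 by rewrite -e.
rewrite vgeE //=; have -> : infinity_val xy z = - ((size (norm A B)).-1)%:Z.
  by have := infinity_valE xy (oner_neq0 _) AB0; rewrite ev1 divr1 -e size_poly1 sub0r.
rewrite size_norm; have [B0|B0] := eqVneq B 0; last first.
  by move: B0; rewrite -size_poly_gt0; move: (size A) (size B) => n m; lia.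
move=> sA; exists A`_0; rewrite e B0 ev0 mul0r addr0 [A]size1_polyC ?evC ?coefC //.
by move: (size A) sA => n; lia.
Qed.

(** The function is x - a and v' is the opposite point (a, -b), which coincides with v at a branch
    point. *)
Lemma vertical_divisor v : v != oo -> exists v', exists2 h : C, h != 0 &
  forall w : place C, w h = coeff w (<< v >> + << v' >> - << (2 : int) *g oo >>).
Proof.
move=> voo; have [a [b [hab xa yb]]] := point_of_place voo.
have h' : (- b) ^+ 2 = a ^+ 3 - a + 1 by rewrite sqrrN.
have v_at := place_at_unique charK xy hab xa yb; pose v' := place_at charK xy h'.
exists v', (x - const C a); first exact: (xa_neq0 a xy).
move=> w; rewrite coeffB coeffD !coeffU !mul1r.
have xa' := place_at_x charK xy h' : vge v' 1 _.
have yb' := place_at_y charK xy h' : vge v' 1 _.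
have v'oo : v' != oo by apply: ge0_place_at.
have [woo|woo] := eqVneq w oo.
  rewrite woo (negbTE voo) (negbTE v'oo) /= mulr1 addr0 sub0r.
  have [|_ e] := @val_addr _ _ oo x (- const C a) (x_neq0 xy).
    by rewrite infinity_x vgeN; apply: vgeW (vge_const _ _).
  exact: etrans e (infinity_x xy).
rewrite mulr0 subr0.
have [wx wy] := ge0_off_infinity woo.
have [xaw|xaw] := boolP (vge w 1 (x - const C a)); last first.
  have ne u : vge u 1 (x - const C a) -> (u == w) = false.
    by move=> ua; apply: contraNF xaw => /eqP <-.
  rewrite (ne _ xa) (ne _ xa') addr0.
  have : vge w 0 (x - const C a) by apply: vgeB.
  move: xaw; rewrite !vgeE ?(xa_neq0 a xy) //; lia.
have [c yc] := residue wy.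
have hc : c ^+ 2 = b ^+ 2.
  apply/eqP; rewrite -subr_eq0; apply/eqP; apply: (@const_vge1 _ _ w).
  have -> : const C (c ^+ 2 - b ^+ 2) = (y - const C b) * (y + const C b) -
    (y + const C c) * (y - const C c) by ring.
  rewrite (y_factor xy hab); apply: vgeB; last by apply: vgeMl => //; apply: vgeD.
  rewrite mulrC; apply: vgeMl => //.
  by apply: vgeB => //; apply: vgeD; [apply: vgeD; [apply: vgeX0 | apply: vgeZ] | apply: vgeX0].
have [b0|b0] := eqVneq b 0.
  have c0 : c = 0 by apply/eqP; move/eqP: hc; rewrite b0 expr0n expf_eq0.
  have yw : vge w 1 (y - const C b) by rewrite b0 -c0.
  have yw' : vge w 1 (y - const C (- b)) by rewrite b0 oppr0 -c0.
  have wv : v = w by rewrite v_at (place_at_unique charK xy hab xaw yw).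
  have wv' : v' = w by rewrite (place_at_unique charK xy h' xaw yw').
  rewrite wv wv' eqxx.
  by have [_ /(_ b0) [_ ->]] := val_place_at charK xy hab xaw yw.
have bb : b != - b.
  by rewrite -subr_eq0 opprK -mulr2n -mulr_natl mulf_neq0 // (natK_neq0 charK 1).
have vv' : v != v'.
  apply: contra bb => /eqP e; rewrite -subr_eq0; apply/eqP; apply: (@const_vge1 _ _ v).
  have -> : const C (b - - b) = (y - const C (- b)) - (y - const C b) by ring.
  by apply: vgeB => //; rewrite e.
move: hc => /eqP; rewrite -subr_eq0 subr_sqr mulf_eq0 subr_eq0 addr_eq0 => /orP[]/eqP ec.
  have yw : vge w 1 (y - const C b) by rewrite -ec.
  have wv : w = v by rewrite v_at (place_at_unique charK xy hab xaw yw).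
  rewrite wv eqxx eq_sym (negbTE vv') addr0.
  by have [/(_ b0) -> _] := val_place_at charK xy hab xa yb.
have yw : vge w 1 (y - const C (- b)) by rewrite -ec.
have wv : w = v' by rewrite (place_at_unique charK xy h' xaw yw).
rewrite wv eqxx (negbTE vv') add0r.
by have [->] := val_place_at charK xy h' xa' yb'; rewrite ?oppr_eq0.
Qed.

Lemma riemann_multiple_infinity n : riemann_dim_ge << n%:Z *g oo >> n.
Proof.
(* The functions 1, x, y, x^2, xy, ... of pole orders 0, 2, 3, ..., n: order 1 does not occur, so
   the index i > 0 stands for order i + 1. *)
pose e (i : 'I_n) : C := if (i == 0 :> nat) then 1 else
  if odd i then x ^+ i.+1./2 else x ^+ i.-2./2 * y.
have e0 i : e i != 0.
  rewrite /e; case: ifP => _; first exact: oner_neq0.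
  by case: ifP => _; rewrite ?mulf_neq0 ?expf_neq0 ?(x_neq0 xy) ?(y_neq0 xy).
have ve i : oo (e i) = - (if (i == 0 :> nat) then 0%N else i.+1)%:Z.
  rewrite /e; case: ifP => i0; first by rewrite val1.
  case: ifP => oi; first by rewrite valX infinity_x mulrn_int; lia.
  rewrite valM ?expf_neq0 ?(x_neq0 xy) ?(y_neq0 xy) // valX infinity_x infinity_y mulrn_int.
  by move: i0 oi; move: (nat_of_ord i) => k; lia.
apply: (@riemann_dim_distinct _ _ oo _ _ e) => //.
  move=> i j eij; apply: val_inj; have := etrans (esym (ve i)) (etrans eij (ve j)).
  by rewrite /=; case: (nat_of_ord i) => [|k]; case: (nat_of_ord j) => [|l] //=; lia.
move=> i v; rewrite coeffU; have [<-|voo] := eqVneq oo v.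
  rewrite vgeE // ve mulr1 lerN2; have := ltn_ord i; case: (nat_of_ord i) => [|k] //=.
rewrite mulr0 oppr0; have [|vx vy] := @ge0_off_infinity _ _ _ _ xy v; first by rewrite eq_sym.
rewrite /e; case: ifP => // _; case: ifP => _; first exact: vgeX0.
by apply: vgeMl => //; apply: vgeX0.
Qed.

(* The inequality holds for large multiples of oo, and is stable under the
   addition of a point v because v ~ 2 oo - v'. *)
Theorem elliptic_riemann_inequality (D : divisor C) n : n%:Z <= deg D -> riemann_dim_ge D n.
Proof.
pose large (E : divisor C) := exists k0 : nat, forall k m : nat, (k0 <= k)%N ->
  m%:Z <= deg E + k%:Z -> riemann_dim_ge (E + << k%:Z *g oo >>) m.
have large0 : large 0.
  exists 0 => k m _; rewrite deg0 !add0r => mk.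
  exact: riemann_dimW mk (riemann_multiple_infinity k).
have largeB E v : large E -> large (E - << v >>).
  move=> [k0 hk0]; exists k0 => k m kk; rewrite degB degU => le.
  by rewrite addrAC; apply/riemann_dimB/hk0 => //; lia.
have largeD E v : large E -> large (E + << v >>).
  move=> lE; have [->|voo] := eqVneq v oo.
    have [k0 hk0] := lE; exists k0 => k m kk; rewrite degD degU => le.
    rewrite -addrA freegUD -[1]/(1%:Z) -PoszD; apply: hk0; lia.
  have [v' [h h0 hdiv]] := vertical_divisor voo.
  have [k0 hk0] := largeB _ v' lE; exists k0 => k m kk; rewrite degD degU => le.
  have hV : h^-1 != 0 by rewrite invr_eq0.
  apply: (riemann_dim_mul hV (A := E - << v' >> + << (k + 2)%N%:Z *g oo >>)); last first.
    by apply: hk0; rewrite ?degB ?degU; lia.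
  move=> f Ef w; have hw : vge w (- w h) h^-1 by rewrite vgeE // valV.
  have := vgeM hw (Ef w); rewrite hdiv !(coeffD, coeffB, coeffU, coeffN).
  congr (vge _ _ _); lia.
have largeE : large D.
  rewrite (fg_decomp D).
  have [s ->] : exists s : seq (place C), fgpos D = \sum_(v <- s) << v >>.
    by apply: effective_pts => v; rewrite coeff_fgposE le_max lexx.
  have [t ->] : exists s : seq (place C), fgneg D = \sum_(v <- s) << v >>.
    by apply: effective_pts => v; rewrite coeff_fgnegE oppr_ge0 ge_min lexx.
  elim: t => [|v t IH]; last by rewrite big_cons opprD addrCA addrC; apply: largeB.
  rewrite big_nil subr0; elim: s => [|v s IH]; first by rewrite big_nil.
  by rewrite big_cons addrC; apply: largeD.
have [k hk] := largeE => nD.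
have -> : D = D + << k%:Z *g oo >> - \sum_(v <- nseq k oo) << v >>.
  by rewrite big_nseq iter_addr_0 freegU_muln natz addrK.
by apply: riemann_dim_pts; rewrite size_nseq; apply: hk => //; lia.
Qed.

Theorem elliptic_genus : has_genus C 1.
Proof.
split=> [D n [_ nmax]|].
  rewrite leNgt; apply/negP => lt; apply: nmax.
  by apply: elliptic_riemann_inequality; lia.
exists << oo >>, 1%N; rewrite degU; split=> //; split.
  by apply: elliptic_riemann_inequality; rewrite degU.
exact: const_riemann_dim riemann_infinity.
Qed.

End Genus.

(** * The lower bound *)

Section LowerBound.
Variables (K : closedFieldType) (S : atiyah_surface K).
Hypothesis charK : [pchar K] =i pred0.
Local Notation C := (base S).
Local Notation q := (basept S).
Local Notation r := (bundle S).
Implicit Types (g h d : {poly C}) (p v : place C) (c a : K) (f : C).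

Lemma coordinates_at (v : place C) : is_curve_y2_x3_x_1 C ->
  exists x y (xy : @coordinates K C x y), v = infinity xy.
Proof.
move=> /curve_coordinates [x [y xy]].
have [->|voo] := eqVneq v (infinity xy); first by exists x, y, xy.
have [a [b [hab xa yb]]] := point_of_place voo.
have := place_at_unique charK xy hab xa yb; rewrite /place_at => ->.
by eexists; eexists; eexists.
Qed.

(** Clears the denominator [d] of the localization: its constant coefficient is a unit, so the
    coefficients of [h] are recovered in increasing order. *)
Lemma coef_unit_mul p d h k : pvge p 0 d -> d`_0 != 0 -> p d`_0 = 0 ->
  (forall i : nat, vge p (k%:Z - i%:Z) (d * h)`_i) -> forall i : nat, vge p (k%:Z - i%:Z) h`_i.
Proof.
move=> d0 d00 pd0 dh i; elim/ltn_ind: i => i IH.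
rewrite -(vge_mull _ _ d00 pd0).
have -> : d`_0 * h`_i = (d * h)`_i - \sum_(j < i) d`_j.+1 * h`_(i - j.+1).
  by rewrite coefM big_ord_recl subn0 addrK.
apply: vgeB => //; apply: vge_sum => j _; have ji := ltn_ord j.
apply: vgeMl => //; apply: vgeW (IH (i - j.+1)%N _); lia.
Qed.

(** The expansion is centred at a function [e] with residue c, because the normalized coordinate
    differs from s by a function that need not be constant. *)
Lemma mult_ge_coef p c e g (m : nat) : p != q -> vge p 0 e -> vge p 1 (e - const C c) ->
  mult_ge (p, c) m g ->
  forall i : nat, vge p (m%:Z - i%:Z) (local_form p g \Po ('X + e%:P))`_i.
Proof.
move=> pq a0 ac [u [u0 pu [d [d0 dc /(coef_ideal_pow a0 ac) [_ dk]]]]] i.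
rewrite coeff_pt eq_sym (negbTE pq) in pu.
have dc0 : vge p 0 d.[const C c] by apply: pvge_horner.
have [da0 pda] : d.[e] != 0 /\ p d.[e] = 0.
  have dc1 : ~~ vge p 1 d.[const C c] by apply/negP => h; apply: dc.
  have dn0 : d.[const C c] != 0 by apply: contraNneq dc1 => ->.
  have pdc : p d.[const C c] = 0 by move: dc0 dc1; rewrite !vgeE //; lia.
  have := @val_addr _ _ p d.[const C c] (d.[e] - d.[const C c]) dn0.
  by rewrite pdc add0r (addrC d.[const C c]) subrK; apply; apply: vge_hornerB.
have X0 : pvge p 0 ('X + e%:P) by rewrite -['X]scale1r; apply: pvge_linear.
have dX : (d \Po ('X + e%:P))`_0 = d.[e] by rewrite -horner_coef0 horner_comp !hornerE.
have := @coef_unit_mul p (d \Po ('X + e%:P)) ((u%:P * local_form p g) \Po ('X + e%:P)) m.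
rewrite dX -comp_polyM => /(_ _ da0 pda dk i) h.
have : vge p (m%:Z - i%:Z) (u%:P * local_form p g \Po ('X + e%:P))`_i by apply/h/pvge_comp.
by rewrite comp_polyM comp_polyC coefCM (vge_mull _ _ u0 pu).
Qed.

Lemma poly6 h : (size h <= 6)%N -> h = (((((h`_5)%:P * 'X + (h`_4)%:P) * 'X + (h`_3)%:P) * 'X +
  (h`_2)%:P) * 'X + (h`_1)%:P) * 'X + (h`_0)%:P.
Proof.
move=> sh; apply/polyP => i; rewrite !(coefD, coefMX, coefC).
do 6![case: i => [|i] //=; rewrite ?add0r ?addr0 //].
by rewrite nth_default // (leq_trans sh).
Qed.

Lemma vge_expansion p (k : nat) c (t f : C) : p t = 1 -> vge p 0 f ->
  vge p k.+1%:Z (const C c + t * f) -> c = 0 /\ vge p k%:Z f.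
Proof.
move=> pt f0 h; have t0 : t != 0 by apply: (@val_gt0 _ _ p); rewrite pt.
have c0 : c = 0.
  apply: (@const_vge1 _ _ p); rewrite -[const C c](addrK (t * f)); apply: vgeB.
    by apply: vgeW h; lia.
  by rewrite mulrC; apply: vgeMl => //; rewrite vgeE // pt.
split=> //; have -> : k%:Z = k.+1%:Z - 1 by lia.
by apply: (vge_divr t0 pt); move: h; rewrite c0 rmorph0 add0r mulrC.
Qed.

Section Normalized.
Variables x y : C.
Hypotheses (xy : coordinates x y) (qoo : q = infinity xy).
Let genus1 : has_genus C 1 := elliptic_genus charK xy.
Let rho := y / x.

Lemma val_q_x : q x = - 2.
Proof. by rewrite qoo infinity_x. Qed.

Lemma val_q_rho : q rho = - 1.
Proof.
by rewrite /rho valM ?invr_eq0 ?(x_neq0 xy) ?(y_neq0 xy) // valV val_q_x qoo infinity_y.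
Qed.

Lemma y_rho : y = rho * x.
Proof. by rewrite /rho divfK ?(x_neq0 xy). Qed.

Lemma regular_simple_const f : (forall v, v != q -> vge v 0 f) -> vge q (- 1) f ->
  exists c, f = const C c.
Proof.
move=> f0 fq; apply: (simple_pole_const genus1 (q := q)) => v; rewrite coeff_pt.
by have [<-|vq] := eqVneq q v; rewrite ?oppr0 //; apply: f0; rewrite eq_sym.
Qed.

(** This is the section t^2 - x at t = y / x, which equals (1 - x) / x^2. The double zero keeps the
    poles of the later sections simple. *)
Lemma vge_q_delta : vge q 2 (rho ^+ 2 - x).
Proof.
have x0 := x_neq0 xy.
have -> : rho ^+ 2 - x = (1 - x) * x^-1 ^+ 2 by rewrite /rho expr_div_n xy.1; field.
have -> : (2 : int) = - 2 + 4 by [].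
apply: vgeM; last by rewrite vgeE ?expf_neq0 ?invr_eq0 // valX valV val_q_x.
by apply: vgeB; [apply: vgeW (vge1 _) | rewrite vgeE // val_q_x].
Qed.

Section Normalize.
Variable h : {poly C}.
Hypotheses (sh : (size h <= 6)%N) (h_reg : forall v, v != q -> pvge v 0 h)
  (h_q : pvge q (- 1) (h \Po ('X + rho%:P))).

(* The polynomials G_l = sum_i C(l, i) e_(l-i) t^i with e = 1, 0, -x, 2y, -3x^2,
   4xy, ... satisfy G_l' = l G_(l-1) and have at most a simple pole at t = rho;
   they form a basis of the sections. *)
Lemma section_shape : exists c0 c1 c2 c3 c4 c5 : K,
  [/\ h`_5 = const C c5, h`_4 = const C c4, h`_3 = const C c3 - const C (10 * c5) * x &
   [/\ h`_2 = const C c2 - const C (6 * c4) * x + const C (20 * c5) * y,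
       h`_1 = const C c1 - const C (3 * c3) * x + const C (8 * c4) * y - const C (15 * c5) * x ^+ 2 &
       h`_0 = const C c0 - const C c2 * x + const C (2 * c3) * y - const C (3 * c4) * x ^+ 2
              + const C (4 * c5) * x * y]].
Proof.
have x0 v : v != q -> vge v 0 x by rewrite qoo => /ge0_off_infinity [].
have y0 v : v != q -> vge v 0 y by rewrite qoo => /ge0_off_infinity [].
have dq := vge_q_delta; set D := rho ^+ 2 - x in dq.
have r1 : vge q (- 1) rho by rewrite vgeE ?val_q_rho // mulf_neq0 ?invr_eq0 ?(x_neq0 xy) ?(y_neq0 xy).
have xq : vge q (- 2) x by rewrite vgeE ?(x_neq0 xy) // val_q_x.
(* Substituting y = rho x, the values of G_2, ..., G_5 at t = rho factor as D, rho D, D (4x + D) and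
   rho D (12x + D). *)
have G2 : vge q (- 1) D by apply: vgeW dq.
have G3 : vge q (- 1) (rho * D) by apply: vgeW (vgeM r1 dq).
have xD : vge q 0 (x * D) := vgeM xq dq.
have D0 : vge q 0 D by apply: vgeW dq.
have G4' : vge q 0 (4 * (x * D) + D ^+ 2).
  by apply: vgeD; [apply: vgeMl | apply: vgeX0].
have G4 : vge q (- 1) (4 * (x * D) + D ^+ 2) by apply: vgeW G4'.
have G5 : vge q (- 1) (rho * (12 * (x * D) + D ^+ 2)).
  by rewrite -[-1]addr0; apply: vgeM => //; apply: vgeD; [apply: vgeMl | apply: vgeX0].
have eq_h : h \Po ('X + rho%:P) = (((((h`_5)%:P * 'X + (h`_4 + 5 * rho * h`_5)%:P) * 'X +
    (h`_3 + 4 * rho * h`_4 + 10 * rho ^+ 2 * h`_5)%:P) * 'X +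
    (h`_2 + 3 * rho * h`_3 + 6 * rho ^+ 2 * h`_4 + 10 * rho ^+ 3 * h`_5)%:P) * 'X +
    (h`_1 + 2 * rho * h`_2 + 3 * rho ^+ 2 * h`_3 + 4 * rho ^+ 3 * h`_4 + 5 * rho ^+ 4 * h`_5)%:P) * 'X +
    (h`_0 + rho * h`_1 + rho ^+ 2 * h`_2 + rho ^+ 3 * h`_3 + rho ^+ 4 * h`_4 + rho ^+ 5 * h`_5)%:P.
  rewrite {1}(poly6 sh) !(comp_polyD, comp_polyM, comp_polyX, comp_polyC); ring.
have hq i := h_q i; rewrite eq_h in hq.
have := hq 0; have := hq 1; have := hq 2; have := hq 3; have := hq 4; have := hq 5.
rewrite !(coefD, coefMX, coefC) /= !(add0r, addr0).
move=> q5 q4 q3 q2 q1 q0 {hq}.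
(* Downwards from the leading coefficient: once the contributions of the higher constants are
   subtracted, a coefficient is regular off q with at most a simple pole at q, hence constant. *)
have [c5 e5] : exists c, h`_5 = const C c.
  by apply: regular_simple_const => // v vq; apply: h_reg.
have [c4 e4] : exists c, h`_4 = const C c.
  apply: regular_simple_const => [v vq|]; first exact: h_reg.
  rewrite -[h`_4](addrK (5 * rho * h`_5)); apply: vgeB => //.
  by rewrite e5 mulrC; apply: vgeZ; apply: vgeMl.
have [c3 e3] : exists c, h`_3 + const C (10 * c5) * x = const C c.
  apply: regular_simple_const => [v vq|].
    by apply: vgeD; [apply: h_reg | apply: vgeZ; apply: x0].
  have -> : h`_3 + const C (10 * c5) * x = h`_3 + 4 * rho * h`_4 + 10 * rho ^+ 2 * h`_5 -
     (const C (4 * c4) * rho + const C (10 * c5) * D) by rewrite e4 e5 /D; ring.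
  by apply: vgeB => //; apply: vgeD; apply: vgeZ.
have {}e3 : h`_3 = const C c3 - const C (10 * c5) * x by rewrite -e3 addrK.
have [c2 e2] : exists c, h`_2 + const C (6 * c4) * x - const C (20 * c5) * y = const C c.
  apply: regular_simple_const => [v vq|].
    by apply: vgeB; [apply: vgeD; [apply: h_reg | apply: vgeZ; apply: x0] | apply: vgeZ; apply: y0].
  have -> : h`_2 + const C (6 * c4) * x - const C (20 * c5) * y =
     h`_2 + 3 * rho * h`_3 + 6 * rho ^+ 2 * h`_4 + 10 * rho ^+ 3 * h`_5 -
     (const C (3 * c3) * rho + const C (6 * c4) * D + const C (10 * c5) * (rho * D)).
    by rewrite e3 e4 e5 /D y_rho; ring.
  by apply: vgeB => //; apply: vgeD; [apply: vgeD|]; apply: vgeZ.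
have {}e2 : h`_2 = const C c2 - const C (6 * c4) * x + const C (20 * c5) * y by rewrite -e2; ring.
have [c1 e1] : exists c, h`_1 + const C (3 * c3) * x - const C (8 * c4) * y +
    const C (15 * c5) * x ^+ 2 = const C c.
  apply: regular_simple_const => [v vq|].
    apply: vgeD; last by apply: vgeZ; apply: vgeX0; apply: x0.
    by apply: vgeB; [apply: vgeD; [apply: h_reg | apply: vgeZ; apply: x0] | apply: vgeZ; apply: y0].
  have -> : h`_1 + const C (3 * c3) * x - const C (8 * c4) * y + const C (15 * c5) * x ^+ 2 =
     h`_1 + 2 * rho * h`_2 + 3 * rho ^+ 2 * h`_3 + 4 * rho ^+ 3 * h`_4 + 5 * rho ^+ 4 * h`_5 -
     (const C (2 * c2) * rho + const C (3 * c3) * D + const C (4 * c4) * (rho * D) +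
      const C (5 * c5) * (4 * (x * D) + D ^+ 2)).
    by rewrite e2 e3 e4 e5 /D y_rho; ring.
  by apply: vgeB => //; apply: vgeD; [apply: vgeD; [apply: vgeD|]|]; apply: vgeZ.
have {}e1 : h`_1 = const C c1 - const C (3 * c3) * x + const C (8 * c4) * y -
    const C (15 * c5) * x ^+ 2 by rewrite -e1; ring.
have [c0 e0] : exists c, h`_0 + const C c2 * x - const C (2 * c3) * y + const C (3 * c4) * x ^+ 2 -
    const C (4 * c5) * x * y = const C c.
  apply: regular_simple_const => [v vq|].
    apply: vgeB; last by rewrite -mulrA; apply: vgeZ; apply: vgeMl; [apply: x0 | apply: y0].
    apply: vgeD; last by apply: vgeZ; apply: vgeX0; apply: x0.
    by apply: vgeB; [apply: vgeD; [apply: h_reg | apply: vgeZ; apply: x0] | apply: vgeZ; apply: y0].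
  have -> : h`_0 + const C c2 * x - const C (2 * c3) * y + const C (3 * c4) * x ^+ 2 -
      const C (4 * c5) * x * y =
     h`_0 + rho * h`_1 + rho ^+ 2 * h`_2 + rho ^+ 3 * h`_3 + rho ^+ 4 * h`_4 + rho ^+ 5 * h`_5 -
     (const C c1 * rho + const C c2 * D + const C c3 * (rho * D) +
      const C c4 * (4 * (x * D) + D ^+ 2) + const C c5 * (rho * (12 * (x * D) + D ^+ 2))).
    by rewrite e1 e2 e3 e4 e5 /D y_rho; ring.
  by apply: vgeB => //; apply: vgeD; [apply: vgeD; [apply: vgeD; [apply: vgeD|]|]|]; apply: vgeZ.
have {}e0 : h`_0 = const C c0 - const C c2 * x + const C (2 * c3) * y - const C (3 * c4) * x ^+ 2
              + const C (4 * c5) * x * y by rewrite -e0; ring.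
by exists c0, c1, c2, c3, c4, c5.
Qed.

(* At the point (0, 1), y = 1 - x / 2 - x^2 / 8 + O(x^3) in terms of the
   uniformizer x. *)
Lemma triple_point_eq0 p : vge p 1 x -> vge p 1 (y - 1) -> p x = 1 ->
  (forall i : nat, vge p (3 - i%:Z) h`_i) -> h = 0.
Proof.
move=> px py vx hp.
have [c0 [c1 [c2 [c3 [c4 [c5 [e5 e4 e3 [e2 e1 e0]]]]]]]] := section_shape.
have x0 : vge p 0 x by apply: vgeW px.
have y0 : vge p 0 y by rewrite -[y](subrK 1); apply: vgeD => //; apply: vgeW py.
have nz n := natK_neq0 charK n.
(* Eight times the error of the Taylor polynomial of y. Its product with the conjugate factor, a
   unit of residue 16, is x^3 (56 - x). *)
pose Y : C := 8 * y - (8 - 4 * x - x ^+ 2).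
have Y3 : vge p 3 Y.
  have [n0 vn] : 8 * y + (8 - 4 * x - x ^+ 2) != 0 /\ p (8 * y + (8 - 4 * x - x ^+ 2)) = 0.
    apply: (@val_unit _ _ p _ 16%:R); first exact: nz.
    have -> : 8 * y + (8 - 4 * x - x ^+ 2) - const C 16%:R = 8 * (y - 1) - (4 + x) * x by ring.
    by apply: vgeB; apply: vgeMl => //; apply: vgeD.
  rewrite -(vge_mull _ _ n0 vn).
  have -> : (8 * y + (8 - 4 * x - x ^+ 2)) * Y = x ^+ 3 * (56 - x).
    have -> : (8 * y + (8 - 4 * x - x ^+ 2)) * Y = 64 * y ^+ 2 - (8 - 4 * x - x ^+ 2) ^+ 2 by rewrite /Y; ring.
    by rewrite xy.1; ring.
  by rewrite mulrC; apply: vgeMl; [apply: vgeB | apply: (vgeX 3 px)].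
have cx (c : K) (f : C) : vge p 0 f -> vge p 0 (const C c + x * f).
  by move=> f0; apply: vgeD => //; apply: vgeMl.
have h0 : vge p 3 (const C (8 * c0 + 16 * c3) + x * (const C (- 8 * c2 - 8 * c3 + 32 * c5) +
    x * (const C (- 2 * c3 - 24 * c4 - 16 * c5) + x * const C (- 4 * c5)))).
  have -> : const C (8 * c0 + 16 * c3) + x * (const C (- 8 * c2 - 8 * c3 + 32 * c5) +
    x * (const C (- 2 * c3 - 24 * c4 - 16 * c5) + x * const C (- 4 * c5))) =
    8 * h`_0 - (const C (2 * c3) + const C (4 * c5) * x) * Y by rewrite e0 /Y; ring.
  apply: vgeB; first by apply: vgeMl => //; have := hp 0; rewrite subr0.
  by apply: vgeMl => //; apply: vgeD => //; apply: vgeZ.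
have h1 : vge p 2 (const C (8 * c1 + 64 * c4) + x * (const C (- 24 * c3 - 32 * c4) +
    x * const C (- 120 * c5 - 8 * c4))).
  have -> : const C (8 * c1 + 64 * c4) + x * (const C (- 24 * c3 - 32 * c4) +
    x * const C (- 120 * c5 - 8 * c4)) = 8 * h`_1 - const C (8 * c4) * Y by rewrite e1 /Y; ring.
  apply: vgeB; first by apply: vgeMl => //; exact: (hp 1).
  by apply: vgeZ; apply: vgeW Y3.
have h2 : vge p 1 (const C (8 * c2 + 160 * c5) + x * (const C (- 48 * c4 - 80 * c5) +
    x * const C (- 20 * c5))).
  have -> : const C (8 * c2 + 160 * c5) + x * (const C (- 48 * c4 - 80 * c5) + x * const C (- 20 * c5)) =
    8 * h`_2 - const C (20 * c5) * Y by rewrite e2 /Y; ring.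
  apply: vgeB; first by apply: vgeMl => //; exact: (hp 2).
  by apply: vgeZ; apply: vgeW Y3.
have [a6 _] := vge_expansion (k := 0) vx (cx _ _ (vge_const p _)) h2.
have [a5 {}h1] := vge_expansion (k := 1) vx (cx _ _ (vge_const p _)) h1.
have [a4 _] := vge_expansion (k := 0) vx (vge_const p _) h1.
have [a1 {}h0] := vge_expansion (k := 2) vx (cx _ _ (cx _ _ (vge_const p _))) h0.
have [a2 {}h0] := vge_expansion (k := 1) vx (cx _ _ (vge_const p _)) h0.
have [a3 _] := vge_expansion (k := 0) vx (vge_const p _) h0.
have z2 : c2 = - (20 * c5).
  by apply: (mulfI (nz 7)); apply/eqP; rewrite -subr_eq0 -[0]a6; apply/eqP; ring.
have z3 : c3 = 24 * c5.
  apply: (mulfI (nz 7)); apply/eqP; rewrite eq_sym -subr_eq0 -[0]a2 z2; apply/eqP; ring.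
have z4 : c4 = - (18 * c5).
  apply: (mulfI (nz 31)); apply/eqP; rewrite eq_sym -subr_eq0 -[0]a4 z3; apply/eqP; ring.
(* The remaining equation is 368 c5 = 0, where 368 = 16 * 23; [nz n] concerns n + 1. *)
have z5 : c5 = 0.
  by apply: (mulfI (nz 367)); rewrite mulr0 -[0]a3 z4 z3; ring.
have {}z2 : c2 = 0 by rewrite z2 z5; ring.
have {}z3 : c3 = 0 by rewrite z3 z5; ring.
have {}z4 : c4 = 0 by rewrite z4 z5; ring.
have z1 : c1 = 0 by apply: (mulfI (nz 7)); rewrite mulr0 -[0]a5 z4; ring.
have z0 : c0 = 0 by apply: (mulfI (nz 7)); rewrite mulr0 -[0]a1 z3; ring.
rewrite (poly6 sh) e0 e1 e2 e3 e4 e5 z0 z1 z2 z3 z4 z5; ring.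
Qed.

End Normalize.
End Normalized.
End LowerBound.

(** * Reduction to the normalized coordinate *)

Section LowerBoundMain.
Variables (K : closedFieldType) (S : atiyah_surface K).
Hypothesis charK : [pchar K] =i pred0.
Local Notation C := (base S).
Local Notation q := (basept S).
Local Notation r := (bundle S).

(* Some coordinate t' = (t - w) / alpha on the generic fibre is a coordinate of S
   off F_q, while t' - y / x is one along F_q. *)
Lemma normal_coordinate x y (xy : @coordinates K C x y) : q = infinity xy ->
  exists w alpha, [/\ alpha != 0, forall v, v != q -> vge v 0 (w - r v) &
    vge q 0 (r q - w - const C alpha * (y / x))].
Proof.
move=> qoo; have [w hw] := approximation (elliptic_genus charK xy) q (ext_finite r).
have w0 v : v != q -> vge v 0 (w - r v).
  by move=> vq; have := hw v; rewrite coeff_pt eq_sym (negbTE vq) oppr0.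
have nsplit : ~~ vge q 0 (w - r q).
  apply/negP => wq; apply: (@nonsplit _ S); exists w => v.
  exists (w - r v), 1; split=> //; last by rewrite mul1r subrK.
  by have [->|/w0] := eqVneq v q.
have vrho := val_q_rho qoo.
have rho0 : y / x != 0 by apply: (@val_lt0 _ _ q); rewrite vrho.
have [|alpha ha] := residue_ratio _ rho0 vrho (f := r q - w).
  by rewrite -opprB vgeN; have := hw q; rewrite coeff_pt eqxx.
exists w, alpha; split=> //; apply: contraNneq nsplit => a0.
by rewrite -opprB vgeN; move: ha; rewrite a0 rmorph0 mul0r subr0.
Qed.

Lemma coef_comp_scaleX (R : comNzRingType) (h : {poly R}) (a : R) i :
  (h \Po (a *: 'X))`_i = a ^+ i * h`_i.
Proof.
elim/poly_ind: h i => [|h b IH] i; first by rewrite comp_poly0 !coef0 mulr0.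
rewrite comp_poly_MXaddC -scalerAr !(coefD, coefZ, coefMX, coefC).
by case: i => [|i] /=; rewrite ?mulr0 ?mul1r // !addr0 IH mulrA exprS.
Qed.

Lemma no_curve_5 x y (xy : @coordinates K C x y) : q = infinity xy ->
  exists s : affine_point S, forall l, (l <= 5)%N -> ~ has_curve 3 s l.
Proof.
move=> qoo; have [w [alpha [al0 w0 wq]]] := normal_coordinate qoo.
have hab : (1 : K) ^+ 2 = 0 ^+ 3 - 0 + 1 by rewrite expr1n expr0n subrr add0r.
pose p := place_at charK xy hab.
have px : vge p 1 x by have := place_at_x charK xy hab; rewrite rmorph0 subr0.
have py : vge p 1 (y - 1) by have := place_at_y charK xy hab; rewrite rmorph1.
have vx : p x = 1.
  have [] := val_place_at charK xy hab (place_at_x charK xy hab) (place_at_y charK xy hab).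
  by rewrite rmorph0 subr0 => ->; rewrite ?oner_neq0.
have pq : p != q.
  by rewrite qoo; apply/eqP => e; move: px; rewrite e vgeE ?(x_neq0 xy) // infinity_x.
(* With t = alpha t' + w, the local coordinate is s = alpha t' + (w - r_p), so the value c of s is
   the point t' = 0. *)
have [c hc] := residue (w0 p pq).
exists (p, c) => l l5 [g [g0 [sg lg] mg]].
have a0 : const C alpha != 0 by rewrite fmorph_eq0.
pose b := const C alpha *: 'X + w%:P.
have sb : size b = 2.
  by rewrite size_polyDl size_scale ?size_polyX // (leq_ltn_trans (size_polyC_leq1 _)).
suff : g \Po b == 0 by rewrite comp_poly2_eq0 // (negbTE g0).
have lf v : g \Po b = local_form v g \Po (const C alpha *: 'X + (w - r v)%:P).
  rewrite /local_form -comp_polyA comp_polyD comp_polyX comp_polyC; congr (_ \Po _).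
  by rewrite -addrA -polyCD subrK.
apply/eqP; apply: (triple_point_eq0 charK qoo _ _ _ px py vx).
- by rewrite size_comp_poly2 //; apply: leq_trans sg _.
- move=> v vq; rewrite (lf v); apply: pvge_comp; last by apply: pvge_linear => //; apply: w0.
  by move=> i; have := lg v i; rewrite coeff_pt eq_sym (negbTE vq) oppr0.
- rewrite (lf q) -comp_polyA; apply: pvge_comp => [i|].
    by have := lg q i; rewrite coeff_pt eqxx.
  rewrite comp_polyD comp_polyZ comp_polyX comp_polyC.
  (* Along F_q the poles of [w - r q] and of [alpha * (y / x)] cancel. *)
  have -> : const C alpha *: ('X + (y / x)%:P) + (w - r q)%:P =
     const C alpha *: 'X + (- (r q - w - const C alpha * (y / x)))%:P.
    by rewrite scalerDr -addrA -mul_polyC -[in LHS]mul_polyC -polyCM -polyCD; congr (_ + _%:P); ring.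
  by apply: pvge_linear => //; rewrite vgeN.
- move=> i; have := mult_ge_coef pq (w0 p pq) hc mg i.
  rewrite (lf p).
  have -> : const C alpha *: 'X + (w - r p)%:P = ('X + (w - r p)%:P) \Po (const C alpha *: 'X).
    by rewrite comp_polyD comp_polyX comp_polyC.
  rewrite comp_polyA => h.
  by rewrite coef_comp_scaleX; apply: vgeMl => //; apply: vgeX0.
Qed.

Theorem lambda0_curve_6 : is_curve_y2_x3_x_1 C -> lambda0_curve 3 S 6.
Proof.
move=> isC; have [x [y [xy qoo]]] := coordinates_at charK q isC.
have genus1 := elliptic_genus charK xy.
split; [exact: lambda0_exists | | by move=> D k _; apply: lambda0_le6].
have [[p c] hs] := no_curve_5 qoo.
exists (<< p >> - << q >>); split; first by rewrite degB !degU.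
exists (p, c); split.
- by exists 1; rewrite ?oner_neq0 // => v; rewrite val1 subrr.
- exact: has_curve_6.
- by move=> l hl; rewrite ltnNge; apply/negP => l5; apply: (hs l).
Qed.

End LowerBoundMain.

(** * Existence of the surface *)

Lemma frac_quotient (R : idomainType) (z : {fraction R}) :
  exists n d : R, d != 0 /\ z = FracField.tofrac n / FracField.tofrac d.
Proof.
elim/quotW: z => z; exists (frac z).1, (frac z).2; split; first exact: denom_ratioP.
have d0 : FracField.tofrac (frac z).2 != 0 by rewrite tofrac_eq0 denom_ratioP.
apply: (mulIf d0); rewrite divfK //; unlock FracField.tofrac; rewrite -[LHS]FracField.pi_mul.
apply/eqmodP; rewrite /= FracField.equivfE /FracField.mulf !numden_Ratio ?(oner_neq0, mulr1, mulf_neq0, denom_ratioP) //.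
by rewrite mulrC.
Qed.

Section Existence.
Variable K : closedFieldType.
Local Notation L := {fraction {poly K}}.
Local Notation frac P := (@FracField.tofrac {poly K} P).

Definition quadratic : {poly L} := 'X^2 - (frac (weierstrass K))%:P.

Lemma size_quadratic : size quadratic = 3%N.
Proof. by rewrite size_polyDl size_polyXn // size_polyN (leq_ltn_trans (size_polyC_leq1 _)). Qed.

(** A root n / d in K(x) would make [norm n d] zero, which the parity of degrees excludes. *)
Lemma quadratic_monic_irreducible : monic_irreducible_poly quadratic.
Proof.
split; last by rewrite monicE lead_coefDl ?lead_coefXn // size_polyXn size_polyN (leq_ltn_trans (size_polyC_leq1 _)).
apply: cubic_irreducible; first by rewrite size_quadratic.
move=> z; apply/negP; rewrite rootE !hornerE subr_eq0 => /eqP.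
have [n [d [d0 ->]]] := frac_quotient z => e.
have : norm n d == 0.
  rewrite /norm subr_eq0 -tofrac_eq tofracXn tofracM tofracXn -e expr_div_n mulrC divfK //.
  by rewrite expf_neq0 // tofrac_eq0.
by rewrite norm_eq0 (negbTE d0) andbF.
Qed.

Definition function_field : fieldType := {poly %/ quadratic with quadratic_monic_irreducible}.

Lemma exists_quadratic_extension : exists (F : fieldType) (j : {rmorphism L -> F}) (y : F),
  y ^+ 2 = j (frac (weierstrass K)) /\ forall z, exists a b, z = j a + j b * y.
Proof.
exists function_field.
pose j0 : {rmorphism L -> {poly %/ quadratic}} := (in_qpoly quadratic \o polyC)%FUN.
exists (j0 : {rmorphism L -> function_field}), (in_qpoly quadratic 'X).
have mk : mk_monic quadratic = quadratic.
  by rewrite /mk_monic size_quadratic quadratic_monic_irreducible.2.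
split.
  apply/eqP; rewrite -subr_eq0; apply/eqP.
  have -> : in_qpoly quadratic 'X ^+ 2 - j0 (frac (weierstrass K)) = in_qpoly quadratic quadratic.
    by rewrite -rmorphXn -rmorphB.
  apply: val_inj => /=; rewrite mk.
  by apply: Pdiv.RingMonic.rmodpp; have [] := quadratic_monic_irreducible.
move=> z; exists (\val z)`_0, (\val z)`_1.
have sz : (size (\val z : {poly L}) < 3)%N by apply: leq_trans (size_mk_monic z) _; rewrite mk size_quadratic.
have ez : z = in_qpoly quadratic (\val z).
  by apply: val_inj; apply: esym; apply: in_qpoly_small; apply: size_mk_monic.
rewrite {1}ez /= -rmorphM -rmorphD; congr (in_qpoly _ _).
apply/polyP => i; rewrite coefD coefCM coefC coefX.
case: i => [|[|i]] /=; rewrite ?mulr0 ?mulr1 ?addr0 ?add0r //.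
by rewrite nth_default // (leq_trans _ (_ : 2 <= i.+2)%N).
Qed.

Lemma exists_curve : exists C : curve K, is_curve_y2_x3_x_1 C.
Proof.
have [F [j [y [y2 gen]]]] := exists_quadratic_extension.
pose cst : {rmorphism K -> F} := (j \o @FracField.tofrac {poly K} \o polyC)%FUN.
pose x := j (frac 'X).
have evx P : (map_poly cst P).[x] = j (frac P).
  elim/poly_ind: P => [|P c IH]; first by rewrite !rmorph0 horner0.
  by rewrite !rmorphD !rmorphM /= map_polyX map_polyC /= hornerMXaddC IH.
have jfrac0 P : P != 0 -> j (frac P) != 0 by rewrite fmorph_eq0 tofrac_eq0.
have fin : is_function_field cst.
  exists x; split=> [P P0|]; first by rewrite evx jfrac0.
  exists 2, (fun i => if i == ord0 then 1 else y) => z.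
  have [a [b ->]] := gen z.
  have [n [d [d0 ->]]] := frac_quotient a; have [n' [d' [d'0 ->]]] := frac_quotient b.
  exists (fun i => if i == ord0 then n else n'), (fun i => if i == ord0 then d else d'); split.
    by move=> i; case: ifP.
  by rewrite big_ord_recl big_ord1 /= !evx mulr1 !fmorph_div.
exists (Curve fin); exists x, y; split.
  by rewrite y2 /weierstrass rmorphD rmorphB rmorphXn rmorph1 /= rmorphD rmorphB rmorphXn rmorph1.
move=> z; have [a [b ->]] := gen z.
have [n [d [d0 ->]]] := frac_quotient a; have [n' [d' [d'0 ->]]] := frac_quotient b.
pose e2 P : F := @eval2 K (Curve fin) P x y.
have e2D P Q : e2 (P + Q) = e2 P + e2 Q by rewrite /e2 /eval2 rmorphD !hornerD.
have e2M P Q : e2 (P * Q) = e2 P * e2 Q by rewrite /e2 /eval2 rmorphM !hornerM.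
have e2X P : e2 (map_poly polyC P) = j (frac P).
  rewrite -evx /e2 /eval2 -map_poly_comp.
  have -> : map_poly (map_poly cst \o polyC) P = map_poly polyC (map_poly cst P).
    by rewrite -map_poly_comp; apply: eq_map_poly => c /=; rewrite map_polyC.
  by rewrite horner_map /= hornerC.
have e2Y : e2 'X%:P = y by rewrite /e2 /eval2 map_polyC /= hornerC map_polyX hornerX.
exists (map_poly polyC (n * d') + map_poly polyC (n' * d) * 'X%:P), (map_poly polyC (d * d')).
rewrite -!/(e2 _) e2D e2M e2Y !e2X; split; first by rewrite jfrac0 // mulf_neq0.
rewrite !fmorph_div !rmorphM /=; field.
by rewrite !jfrac0.
Qed.

End Existence.

(** * A nonsplit extension on the elliptic curve *)

Section Surface.
Variables (K : closedFieldType) (C : curve K).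
Hypothesis charK : [pchar K] =i pred0.
Variables x y : C.
Hypothesis xy : coordinates x y.
Local Notation oo := (infinity xy).

(* y / x has a simple pole at oo, hence represents a nonzero class in H^1(E, O). *)
Definition atiyah_class (v : place C) : C := if v == oo then y / x else 0.

Lemma atiyah_class_finite : exists s : seq (place C), forall p, p \notin s -> vge p 0 (atiyah_class p).
Proof.
exists [:: oo] => p; rewrite /atiyah_class; case: eqP => [->|_ _]; last exact: vge0.
by rewrite mem_head.
Qed.

(** A splitting would be a function with at most a simple pole at [oo], hence constant, and yet
    would share the pole of y / x. *)
Lemma atiyah_class_nonsplit : ~ split_extension (Extension atiyah_class_finite).
Proof.
move=> [g hg].
have hv v : vge v 0 (g - atiyah_class v).
  by have [a [b [a0 _ [-> <-]]]] := hg v; rewrite mul1r addrK.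
have vyx : oo (y / x) = -1.
  by rewrite valM ?invr_eq0 ?(x_neq0 xy) ?(y_neq0 xy) // valV infinity_x infinity_y.
have goo : vge oo 0 (g - y / x) by have := hv oo; rewrite /atiyah_class eqxx.
have [c gc] : exists c, g = const C c.
  apply: (riemann_infinity charK (xy := xy)) => v; rewrite coeff_pt.
  have [<-|voo] := eqVneq oo v; last first.
    by have := hv v; rewrite /atiyah_class eq_sym (negbTE voo) subr0 oppr0.
  rewrite -[g](subrK (y / x)); apply: vgeD; first by apply: vgeW goo.
  by rewrite /vge vyx orbT.
have : vge oo 0 (y / x) by rewrite -[y / x](subKr g); apply: vgeB; rewrite // gc.
by rewrite vgeE ?vyx // (@val_lt0 _ _ oo) // vyx.
Qed.

End Surface.

Lemma exists_surface (K : closedFieldType) (charK : [pchar K] =i pred0) :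
  exists S : atiyah_surface K, is_curve_y2_x3_x_1 (base S).
Proof.
have [C isC] := exists_curve K; have [x [y xy]] := curve_coordinates isC.
by exists (AtiyahSurface (infinity xy) (atiyah_class_nonsplit charK (xy := xy))).
Qed.

Theorem corollary2p8 (K : closedFieldType) (charK : [pchar K] =i pred0) :
  (forall S : atiyah_surface K, is_curve_y2_x3_x_1 (base S) -> lambda0_curve 3 S 6) /\
  lambda0_gen K 3 6.
Proof.
have lambda6 (S : atiyah_surface K) : is_curve_y2_x3_x_1 (base S) -> lambda0_curve 3 S 6 by exact: lambda0_curve_6.
split=> //; split; [exact: lambda0_curve_exists | | by move=> S k g1; apply: lambda0_curve_le6].
have [S isC] := exists_surface charK; exists S; split; last exact: lambda6.
have [x [y xy]] := curve_coordinates isC; exact: elliptic_genus xy.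
Qed.
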